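(* Let $q,k \in \mathbb{N}$ with $2 \le q \le k/2$. The $q$-chorded $k$-cycle inequality \[ \sum_{i \in \mathbb{Z}_k} \left( x_{\{i,i+1\}} - x_{\{i,i+q\}} \right) \le k - \left\lceil \tfrac{k}{q} \right\rceil \] induces a facet of the clique partitioning polytope $\mathrm{CPP}_k$ if and only if both of the following hold: (i) $k \equiv 1 \pmod q$; (ii) if $k = 3q+1$, then $q = 3$ or $q$ is even.
   Context: For $n \in \mathbb{N}$, let $K_n=(V_n,E_n)$ be the complete graph with $E_n=\binom{V_n}{2}$; here the node set is identified with $\mathbb{Z}_k$ (integers modulo $k$), so indices like $i+1$, $i+q$ are taken modulo $k$. For a partition $\Pi$ of the node set, $x^\Pi \in \{0,1\}^{E_n}$ is defined by $x^\Pi_{\{i,j\}}=1$ iff $i,j$ lie in the same block of $\Pi$. The clique partitioning polytope $\mathrm{CPP}_n$ is the convex hull of all vectors $x^\Pi$ over partitions $\Pi$ of $V_n$ (equivalently, of all $x\in\{0,1\}^{E_n}$ with $x_{\{i,j\}}+x_{\{j,l\}}-x_{\{i,l\}}\le 1$ for all pairwise distinct $i,j,l$); it is full-dimensional in $\mathbb{R}^{E_n}$. An inequality induces a facet if it is valid for the polytope and the face of points attaining equality has dimension one less than the polytope. *)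

(* Defs.v *)
From HB Require Import structures.
From mathcomp Require Import all_boot all_order all_algebra.
From mathcomp Require Import boolp classical_sets reals.

Set Implicit Arguments.
Unset Strict Implicit.
Unset Printing Implicit Defensive.

Import Order.TTheory GRing.Theory Num.Theory.

Local Open Scope ring_scope.

Section Polyhedral.
Variables (R : realType) (U : lmodType R).
Implicit Types (X P : set U) (f : U -> R) (b : R) (d : int).

Definition convex_hull X : set U := fun x =>
  exists (n : nat) (p : 'I_n -> U) (c : 'I_n -> R),
    [/\ forall i, X (p i), forall i, 0 <= c i, \sum_i c i = 1
      & x = \sum_i c i *: p i].

Definition affinely_independent (n : nat) (p : 'I_n -> U) : Prop :=
  forall c : 'I_n -> R,
    \sum_i c i = 0 -> \sum_i c i *: p i = 0 -> forall i, c i = 0.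

(* One less than the maximal number of affinely independent points of X; in
   particular the empty set has dimension -1. *)
Definition has_dimension X d : Prop :=
  exists n : nat,
    [/\ d = n%:Z - 1,
        exists p : 'I_n -> U, affinely_independent p /\ forall i, X (p i)
      & forall (m : nat) (p : 'I_m -> U),
          affinely_independent p -> (forall i, X (p i)) -> (m <= n)%N].

Definition valid P f b : Prop := forall x, P x -> f x <= b.

Definition face P f b : set U := fun x => P x /\ f x = b.

Definition induces_facet P f b : Prop :=
  valid P f b /\
  exists d, has_dimension P d /\ has_dimension (face P f b) (d - 1).

End Polyhedral.

Section CliquePartitioning.
Variables (R : realType) (V : finType).

Definition edge : finType := {e : {set V} | #|e| == 2}.

(* The codomain is R^o rather than R, so that the functions form an R-module. *)
Definition edge_vector : lmodType R := {ffun edge -> R^o}.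

(* The coordinate of x at {i, j}; it is set to 0 when i = j. *)
Definition coord_at (x : edge_vector) (i j : V) : R :=
  if insub [set i; j]%SET is Some e then x e else 0.

Definition partition_vector (Pi : {set {set V}}) : edge_vector :=
  [ffun e : edge => ([exists B in Pi, val e \subset B] : nat)%:R].

Definition CPP : set edge_vector :=
  convex_hull (fun x => exists2 Pi : {set {set V}},
    finset.partition Pi [set: V]%SET & x = partition_vector Pi).

End CliquePartitioning.

(* Indices are added modulo k in 'Z_k, which is the ring of integers modulo k
   only for k > 1. If k = 2q, every {i, i + q} occurs twice in the sum. *)
Definition chorded_cycle_lhs (R : realType) (q k : nat)
    (x : edge_vector R 'Z_k) : R :=
  \sum_(i : 'Z_k) (coord_at x i (i + 1) - coord_at x i (i + q%:R)).

Definition chorded_cycle_rhs (R : realType) (q k : nat) : R :=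
  k%:R - (Num.ceil (k%:R / q%:R : R))%:~R.

(* Main.v *)
(* For a partition, call [i] a cut if [i] and [i+1] lie in different blocks and a
   chord if [i] and [i+q] lie in the same block. Every window [i, i+q] without a
   cut makes [i] a chord, so q cuts + chords >= k, hence cuts + chords >= k/q; this
   is the inequality.

   If k is not 1 modulo q, a tight partition has no chord at all, so x_{0,q} = 0 on
   the face. If k = 3q+1 with q odd and q > 3, all tight partitions satisfy
   sum_i (-1)^i x_{i,i+q+2} = 0. In both cases the face lies in two independent
   hyperplanes.

   Otherwise write k = mq+1 and let [a] be (the coefficients of) an equation valid on
   all tight partitions. These are essentially the decompositions of the cycle into
   m+1 segments of length at most q; moving one vertex between neighbouring segments
   determines the coefficients of the edges of length at most q up to a common
   factor. Merging two nonadjacent segments I and J gives a(I, J) = 0, and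
   differences of such rectangles kill the longer edges: directly if m >= 4, while
   for m = 3 they only give a(x+q, y+q) = - a(x, y), which is where the parity of q
   comes in. *)
Require Import Defs.
From mathcomp Require Import all_boot all_order all_algebra.
From mathcomp Require Import boolp classical_sets reals.
From mathcomp Require Import zify ring lra.

Set Implicit Arguments.
Unset Strict Implicit.
Unset Printing Implicit Defensive.

Import Order.TTheory GRing.Theory Num.Theory.

(** * Cuts and chords of periodic labellings *)

Lemma big_shift_period (S : Type) (idx : S) (op : Monoid.com_law idx)
    (k s : nat) (F : nat -> S) :
  (forall i, F (i + k) = F i) ->
  \big[op/idx]_(0 <= i < k) F (i + s) = \big[op/idx]_(0 <= i < k) F i.
Proof.
move=> hF; elim: s => [|s IH]; first by under eq_bigr do rewrite addn0.
rewrite -IH; case: k hF {IH} => [|k] hF; first by rewrite !big_geq.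
rewrite big_nat_recr // [in RHS]big_nat_recl //= [in RHS]Monoid.mulmC.
by congr (op _ _); [under eq_bigr do rewrite addnS -addSn
                   | rewrite -[RHS]hF; congr F; lia].
Qed.

Definition cnt (P : nat -> bool) (i n : nat) : nat := \sum_(0 <= j < n) P (i + j).

Section Counting.
Variable P : nat -> bool.

Lemma cnt0 i : cnt P i 0 = 0. Proof. by rewrite /cnt big_geq. Qed.

Lemma cntS i n : cnt P i n.+1 = P i + cnt P i.+1 n.
Proof.
by rewrite /cnt big_nat_recl // addn0; under eq_bigr do rewrite addnS -addSn.
Qed.

Lemma cntD i n m : cnt P i (n + m) = cnt P i n + cnt P (i + n) m.
Proof.
elim: n i => [|n IH] i; first by rewrite cnt0 addn0.
by rewrite addSn !cntS IH addnA addSnnS.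
Qed.

Lemma cnt1 i : cnt P i 1 = P i.
Proof. by rewrite cntS cnt0 addn0. Qed.

Lemma cnt_period k i : (forall j, P (j + k) = P j) -> cnt P i k = cnt P 0 k.
Proof.
move=> hP; rewrite /cnt; under [RHS]eq_bigr do rewrite add0n.
rewrite -(@big_shift_period _ _ addn k i (fun j => P j : nat)) //=.
  by apply: eq_bigr => j _; rewrite addnC.
by move=> j; rewrite hP.
Qed.

Lemma sum_cnt k q : (forall j, P (j + k) = P j) ->
  \sum_(0 <= i < k) cnt P i q = q * cnt P 0 k.
Proof.
move=> hP; rewrite /cnt exchange_big /=.
rewrite (eq_bigr (fun=> cnt P 0 k)) ?sum_nat_const_nat ?subn0 // => j _.
by rewrite -(cnt_period j hP) /cnt; apply: eq_bigr => i _; rewrite addnC.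
Qed.

End Counting.

Definition cut (T : eqType) (u : nat -> T) (i : nat) : bool := u i != u i.+1.

Definition chord (T : eqType) (q : nat) (u : nat -> T) (i : nat) : bool :=
  u i == u (i + q).

(* The number of terms [x_{i,i+1}] that vanish plus the number of terms
   [x_{i,i+q}] that do not: the inequality says that it is at least [k/q]. *)
Definition load (T : eqType) (q k : nat) (u : nat -> T) : nat :=
  cnt (cut u) 0 k + cnt (chord q u) 0 k.

Section PeriodicLabels.
Variables (T : eqType) (q k : nat) (u : nat -> T).
Hypothesis hu : forall i, u (i + k) = u i.

Local Notation ncut := (cnt (cut u)).
Local Notation nchord := (cnt (chord q u)).

Lemma cut_period i : cut u (i + k) = cut u i.
Proof. by rewrite /cut -addSn !hu. Qed.

Lemma chord_period i : chord q u (i + k) = chord q u i.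
Proof. by rewrite /chord hu addnAC hu. Qed.

Lemma ncut_eq0 i n : ncut i n = 0 -> u i = u (i + n).
Proof.
elim: n i => [|n IH] i; first by rewrite addn0.
rewrite cntS /cut; case: eqP => //= ->; rewrite add0n => /IH ->.
by rewrite addSnnS.
Qed.

Lemma ncut_eq1 i n : ncut i n = 1 -> u i <> u (i + n).
Proof.
elim: n i => [|n IH] i; first by rewrite cnt0.
rewrite cntS /cut; case: eqP => [->|ne] /=; rewrite -addSnnS.
  by rewrite add0n => /IH.
by move=> h; case: h => h; rewrite -(ncut_eq0 h).
Qed.

Lemma window i : 0 < ncut i q + chord q u i.
Proof.
rewrite lt0n addn_eq0; apply/negP => /andP[/eqP /ncut_eq0 h].
by rewrite /chord h eqxx.
Qed.

Lemma window_sum : k <= q * ncut 0 k + nchord 0 k.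
Proof.
rewrite -(sum_cnt q cut_period) [X in _ + X]/cnt -big_split /=.
rewrite -[X in X <= _](subn0 k) -[X in X <= _]muln1 -sum_nat_const_nat.
by apply: leq_sum => i _; apply: window.
Qed.

Lemma nchord_ge2 i d : 0 < d < k -> chord q u i -> chord q u (i + d) ->
  1 < nchord 0 k.
Proof.
case/andP=> d0 dk h1 h2; rewrite -(cnt_period i chord_period).
have -> : k = 1 + ((d - 1) + (1 + (k - d - 1))) by lia.
rewrite !cntD !cnt1 h1.
have -> : i + 1 + (d - 1) = i + d by lia.
by rewrite h2; lia.
Qed.

Lemma nchord_gt0 i : 0 < k -> chord q u i -> 0 < nchord 0 k.
Proof.
by case: k chord_period => // k' hP _ h; rewrite -(cnt_period i hP) cntS h.
Qed.

End PeriodicLabels.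

Section LoadBounds.
Variables (T : eqType) (q k : nat) (u : nat -> T).
Hypothesis hu : forall i, u (i + k) = u i.

Local Notation ncut := (cnt (cut u)).
Local Notation nchord := (cnt (chord q u)).

(** [(k + q.-1) %/ q] is the ceiling of [k/q]; by [window_sum], [q] times the integer load is at
    least [k]. *)
Lemma load_ge : 0 < q -> (k + q.-1) %/ q <= load q k u.
Proof.
move=> q0; rewrite -ltnS ltn_divLR // /load.
have := window_sum q hu; nia.
Qed.

(** By [window_sum], [q] times the load is at least [k] plus [q - 1] for each chord, whereas [q]
    times the ceiling of [k/q] exceeds [k] by less than [q - 1] unless [k] is 1 modulo [q]. *)
Lemma tight_chord_free i : 1 < q -> 0 < k -> k %% q != 1 ->
  load q k u = (k + q.-1) %/ q -> chord q u i = false.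
Proof.
move=> q1 k0 r1 ht; apply/negbTE/negP => /(nchord_gt0 hu k0).
have := window_sum q hu; move: ht; rewrite /load.
have := divn_eq k q; have := ltn_pmod k (ltnW q1).
have := divn_eq (k + q.-1) q; have := ltn_pmod (k + q.-1) (ltnW q1).
set r := k %% q in r1 *; set m := k %/ q; set C := _ %/ q; set r' := (_ + _) %% q.
move=> r'q CE rq kE ht hw hd.
have : q * C + (q - 1) * (1 - nchord 0 k) <= q * C by nia.
have : C <= m + (0 < r) by rewrite -ltnS; case: (posnP r) => hr; nia.
case: (posnP r) => hr hC _; nia.
Qed.

(** The weight [w] grows at every cut inside [[0, k)] and so bounds their number; the step from
    [k - 1] back to 0 adds at most one cut. The flag [c] permits a single chord, at 0. Chords from
    the last [q] positions wrap around and are excluded by the hypothesis on [i + (k - q)]. *)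
Lemma load_of_weight m (w : nat -> nat) (c : bool) : q < k ->
  (forall i, i.+1 < k -> w i <= w i.+1 /\ (u i <> u i.+1 -> w i < w i.+1)) ->
  (forall i, i + q < k -> u i = u (i + q) -> c /\ i = 0) ->
  (forall i, i < q -> u i <> u (i + (k - q))) ->
  w k.-1 + c <= m + w 0 -> load q k u <= m.+1.
Proof.
move=> qk hw hc1 hc2 hm.
have hcut n : n < k -> w 0 + ncut 0 n <= w n.
  elim: n => [|n IH] nk; first by rewrite cnt0; lia.
  have := IH (ltnW nk); have [w1 w2] := hw _ nk.
  rewrite -addn1 cntD cnt1 add0n /cut addn1; case: eqP w2 => [_ _|ne /(_ ne)] /=; lia.
have hch : nchord 0 k <= c.
  rewrite -{1}(subnK (ltnW qk)) cntD.
  have -> : nchord (0 + (k - q)) q = 0.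
    rewrite /cnt big_nat big1 // => i /= iq; rewrite /chord; case: eqP => //.
    have -> : 0 + (k - q) + i + q = i + k by lia.
    rewrite hu => h; case: (hc2 _ iq); rewrite -h; congr u; lia.
  have -> : k - q = (k - q).-1.+1 by lia.
  rewrite cntS addn0 [X in _ + X](_ : _ = 0).
    rewrite addn0 /chord; case: eqP => //= h; case: (hc1 0) => //; lia.
  rewrite /cnt big_nat big1 // => i /= iq; rewrite /chord; case: eqP => //.
  by move=> h; case: (hc1 (1 + i)) => //; lia.
rewrite /load; have -> : ncut 0 k = ncut 0 k.-1 + cut u k.-1.
  by rewrite -[X in cnt _ _ X](_ : k.-1 + 1 = k) ?cntD ?cnt1 ?add0n //; lia.
have := hcut k.-1; lia.
Qed.

End LoadBounds.

(** * The case [k = 3q + 1] with [q] odd and at least 5 *)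

Section FourSegments.
Local Open Scope ring_scope.
Variables (T : eqType) (q k : nat) (u : nat -> T).
Hypothesis hu : forall i, u (i + k)%N = u i.
Hypotheses (oq : odd q) (q5 : (5 <= q)%N) (kE : k = (3 * q + 1)%N).
Hypothesis tight : load q k u = 4.

Local Notation ncut := (cnt (cut u)).
Local Notation nchord := (cnt (chord q u)).
Local Notation far i := (u i == u (i + (q + 2))%N).
Local Notation bridge i := (u i == u (i + (q + 1))%N).
(** Bridges that cannot be extended at one end: [bridge_l i] runs from [i + 1] to [i + q + 2] and is
    blocked at [i], [bridge_r i] runs from [i] to [i + q + 1] and is blocked at [i + q + 2]. *)
Local Notation bridge_l i := (bridge i.+1 && cut u i).
Local Notation bridge_r i := (bridge i && cut u (i + (q + 1))).

Lemma ncutE i : ncut i k = ncut 0%N k.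
Proof. exact: cnt_period (cut_period hu). Qed.

(** Tightness allows at most one chord, so every window longer than [q] contains a cut. Equal labels
    at [i] and [i + q + 2] exclude exactly one cut on either arc between them; hence both arcs have
    at least two, which exhausts the load 4. *)
Lemma far_tight i : far i ->
  [/\ nchord 0%N k = 0%N, ncut 0%N k = 4 & ncut i (q + 2) = 2].
Proof.
move=> /eqP hi; have d1 : (nchord 0 k <= 1)%N.
  by have := window_sum q hu; move: tight; rewrite /load kE; nia.
have two j n : (q < n)%N -> ncut j n != 0%N.
  move=> qn; apply/eqP => h0.
  have : ncut j (q + (1 + (n - q - 1))) = 0%N by rewrite -h0; congr cnt; lia.
  have : ncut j (1 + (q + (n - q - 1))) = 0%N by rewrite -h0; congr cnt; lia.
  rewrite !cntD => h1 h2.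
  have c1 : chord q u j by apply/eqP/ncut_eq0; lia.
  have c2 : chord q u (j + 1) by apply/eqP/ncut_eq0; lia.
  have := nchord_ge2 hu _ c1 c2; lia.
have n1 : ncut i (q + 2) <> 1%N by move/ncut_eq1.
have n2 : ncut (i + (q + 2)) (2 * q - 1) <> 1%N.
  move/ncut_eq1; apply; rewrite -hi -[LHS]hu; congr u; lia.
have := two i (q + 2)%N; have := two (i + (q + 2))%N (2 * q - 1)%N.
have := ncutE i; rewrite [X in ncut i X](_ : _ = (q + 2) + (2 * q - 1))%N; last lia.
rewrite cntD; move: tight; rewrite /load; split; lia.
Qed.

Hypothesis chords0 : nchord 0%N k = 0%N.

Lemma no_chord i : u i != u (i + q)%N.
Proof.
apply/negP => /(nchord_gt0 hu); rewrite chords0; lia.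
Qed.

Lemma ncut4 i : ncut i k = 4.
Proof. by rewrite ncutE; move: tight; rewrite /load chords0 addn0. Qed.

Lemma window1 i : (0 < ncut i q)%N.
Proof. by have := window q u i; rewrite /chord (negbTE (no_chord i)) addn0. Qed.

(** If the first or the last step inside the bridge were no cut, dropping it would leave a chord. *)
Lemma bridge_cut i : bridge i -> cut u i /\ cut u (i + q).
Proof.
move=> /eqP hi; split; apply/eqP => h.
  have := no_chord i.+1; rewrite -h hi; case/eqP; congr u; lia.
have := no_chord i; rewrite h hi; case/eqP; congr u; lia.
Qed.

(** Of the two cuts on the short arc of a far pair, at least one lies in the inner window from
    [i + 1] to [i + q + 1]. If neither end step were a cut, that window would be a chord; so exactly
    one is, and the pair extends exactly one bridge. *)
Lemma farE i :
  (far i : nat) = ((bridge i && ~~ cut u (i + (q + 1))) +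
                   (bridge i.+1 && ~~ cut u i))%N.
Proof.
have e1 : (i + (q + 1)).+1 = (i + (q + 2))%N by lia.
have e2 : (i.+1 + (q + 1))%N = (i + (q + 2))%N by lia.
rewrite /cut e1 e2 !negbK.
have [hi|hi] := boolP (far i); last first.
  rewrite (_ : _ && _ = false); last first.
    by apply/negP => /andP[/eqP h1 /eqP h2]; rewrite h1 h2 eqxx in hi.
  rewrite (_ : _ && _ = false) //.
  by apply/negP => /andP[/eqP h1 /eqP h2]; rewrite h2 h1 eqxx in hi.
have [_ _ h2] := far_tight hi; move/eqP in hi; rewrite -hi.
move: h2; have -> : (q + 2 = 1 + (q + 1))%N by lia.
rewrite !cntD !cnt1 /cut.
have -> : (i + 1 + q)%N = (i + (q + 1))%N by lia.
rewrite e1 -hi addn1; have := no_chord i.+1.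
rewrite (_ : i.+1 + q = i + (q + 1))%N; last lia.
rewrite [u i.+1 == u i]eq_sym [u (i + (q + 1))%N == u i]eq_sym.
move=> nc; have := window1 i.+1; rewrite /cut.
have [e|] := eqVneq (u i) (u i.+1); have [e'|] /= := eqVneq (u i) (u (i + (q + 1))%N) => //.
  by rewrite -e -e' eqxx in nc.
lia.
Qed.

(** Either side puts the four cuts at [i], [i + 1], [i + q + 1] and [i + 2q + 1]: three come from
    [bridge_cut] and the blocked end, and the windows of length [q] force the fourth. So [i + q + 2]
    to [i + 2q + 1] is one segment, and both sides say that it has the label of [i + 1]. *)
Lemma bridge_shift i : bridge_l i = bridge_r (i + (2 * q + 1)).
Proof.
have := ncut4 i.
rewrite [X in ncut i X](_ : _ =
  1 + (1 + ((q - 1) + (1 + ((q - 1) + (1 + (q - 1)))))))%N; last lia.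
rewrite !cntD !cnt1.
have -> : (i + 1 + 1 = i + 2)%N by lia.
have -> : (i + 2 + (q - 1) = i + (q + 1))%N by lia.
have -> : (i + (q + 1) + 1 = i + (q + 2))%N by lia.
have -> : (i + (q + 2) + (q - 1) = i + (2 * q + 1))%N by lia.
have wl n : (0 < ncut n (q - 1) + cut u (n + (q - 1)))%N.
  by rewrite -cnt1 -cntD subnK ?window1 //; lia.
have wr n : (0 < cut u n + ncut (n + 1) (q - 1))%N.
  by rewrite -cnt1 -cntD subnKC ?window1 //; lia.
have := wr (i + (2 * q + 1))%N; have := wl (i + (q + 2))%N.
have := wr (i + (q + 1))%N; have := wl (i + 2)%N.
have -> : (i + 2 + (q - 1) = i + (q + 1))%N by lia.
have -> : (i + (q + 1) + 1 = i + (q + 2))%N by lia.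
have -> : (i + (q + 2) + (q - 1) = i + (2 * q + 1))%N by lia.
move=> w1 w2 w3 w4; rewrite (addn1 i) => tot.
have eL : (i.+1 + (q + 1))%N = (i + (q + 2))%N by lia.
have eR : u (i + (2 * q + 1) + (q + 1))%N = u i.+1.
  by rewrite -[RHS]hu; congr u; lia.
have ecut : cut u (i + (2 * q + 1) + (q + 1)) = cut u i.+1.
  by rewrite -[RHS](cut_period hu); congr cut; lia.
have mid : ncut (i + (q + 2)) (q - 1) = 0%N -> u (i + (q + 2))%N = u (i + (2 * q + 1))%N.
  by move/ncut_eq0 ->; congr u; lia.
apply/idP/idP => /andP[].
  move=> hb hc; have [c1 c2] := bridge_cut hb; move: hb; rewrite eL => /eqP hb.
  rewrite ecut eR c1 andbT hb mid ?eqxx //.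
  move: c2; rewrite (_ : i.+1 + q = i + (q + 1))%N; last lia.
  move=> c2; move: tot; rewrite hc c1 c2; lia.
move=> hb hc; have [c1 c2] := bridge_cut hb; move: hb; rewrite eR ecut in hc *.
move=> /eqP hb; rewrite eL -hb.
have c3 : cut u i.
  by rewrite -(cut_period hu) kE -[X in cut u X](_ : i + (2 * q + 1) + q = _)%N //; lia.
rewrite c3 andbT mid ?eqxx //.
move: tot; rewrite c3 hc c1; lia.
Qed.

End FourSegments.

(* Writing a pair at distance [q + 2] as a bridge [p, p + q + 1] extended by one
   vertex at either end, the sum telescopes up to the bridges that cannot be
   extended; [bridge_shift] pairs these off with opposite signs. *)
Lemma alternating_sum (R : comNzRingType) (T : eqType) (q k : nat) (u : nat -> T) :
  (forall i, u (i + k) = u i) -> odd q -> 5 <= q -> k = 3 * q + 1 ->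
  load q k u = 4 ->
  (\sum_(0 <= i < k) (-1) ^+ i * (u i == u (i + (q + 2))%N)%:R = 0 :> R)%R.
Proof.
move=> hu oq q5 kE tight.
have [c0|c0] := eqVneq (cnt (chord q u) 0 k) 0; last first.
  rewrite big1_seq // => i _; case: (boolP (u i == _)) => [h|_]; last by rewrite mulr0.
  by have [/eqP] := far_tight hu oq q5 kE tight h; rewrite (negbTE c0).
pose b i := u i == u (i + (q + 1)).
pose V i := b i && cut u (i + (q + 1)); pose U i := b i.+1 && cut u i.
have per i : b (i + k) = b i by rewrite /b hu addnAC hu.
have sgn (i j : nat) : odd j -> ((-1) ^+ (i + j)%N = - (-1) ^+ i :> R)%R.
  by move=> oj; rewrite exprD -[X in (_ * X)%R]signr_odd oj mulrN1.
(* As [k] is even, the sign is periodic, and rotating by an odd amount negates the sum. *)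
have shift j (F : nat -> bool) : (forall i, F (i + k) = F i) -> odd j ->
    (\sum_(0 <= i < k) (-1) ^+ i * (F (i + j)%N)%:R
     = - \sum_(0 <= i < k) (-1) ^+ i * (F i)%:R :> R)%R.
  move=> hF oj; rewrite -(@big_shift_period _ _ +%R k j (fun i => (-1) ^+ i * (F i)%:R)%R).
    by rewrite -sumrN; apply: eq_bigr => i _; rewrite sgn // mulNr opprK.
  move=> i; rewrite hF exprD -[X in (_ * X * _)%R]signr_odd (_ : odd k = false) ?mulr1 //.
  by rewrite kE oddD oddM oq.
have -> : (\sum_(0 <= i < k) (-1) ^+ i * (u i == u (i + (q + 2))%N)%:R
  = \sum_(0 <= i < k) (-1) ^+ i * (b i)%:R + \sum_(0 <= i < k) (-1) ^+ i * (b (i + 1)%N)%:R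
    - (\sum_(0 <= i < k) (-1) ^+ i * (V i)%:R + \sum_(0 <= i < k) (-1) ^+ i * (U i)%:R)
    :> R)%R.
  rewrite -!big_split /= -sumrB; apply: eq_bigr => i _.
  rewrite -!mulrDr -mulrBr; congr (_ * _)%R.
  rewrite (farE hu oq q5 kE tight c0) (addn1 i) /V /U /b.
  case: (u i == _); case: (u i.+1 == _); case: (cut u i); case: (cut u _) => /=; ring.
rewrite shift // subrr sub0r
  [X in (_ + X)%R](eq_bigr (fun i => (-1) ^+ i * (V (i + (2 * q + 1))%N)%:R)%R).
  rewrite shift ?addrN ?oppr0 // => [i|]; last by rewrite oddD oddM.
  by rewrite /V per addnAC cut_period.
by move=> i _; rewrite /U /b (bridge_shift hu oq q5 kE tight c0).
Qed.

(** * Equations valid on all tight partitions *)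

(* The index at position [t] of the segments of [0, k) when these are, in this
   order, one of length [i], [g] of length [q], one reaching to [e], and then
   segments of length [q] with a possibly shorter last one. *)
Definition seg (q i g e t : nat) : nat :=
  if t < i then 0 else if t < e then ((t - i) %/ q).+1 else g.+2 + (t - e) %/ q.

Section Segments.
Variables (q i g e : nat).
Hypotheses (q0 : 0 < q) (iq : 0 < i <= q).
Hypotheses (ge : i + g * q < e) (eg : e <= i + g * q + q).
Hypothesis ie : i + g * q + q < e + i.

Local Notation seg := (seg q i g e).

Lemma lt_ie : i < e. Proof. nia. Qed.

Lemma seg_mid t : t < e -> (t - i) %/ q <= g.
Proof. by move=> te; rewrite -ltnS ltn_divLR //; lia. Qed.

Lemma leq_seg t : seg t <= seg t.+1.
Proof.
have := @seg_mid t; have := @leq_div2r q (t - i) (t.+1 - i).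
have := @leq_div2r q (t - e) (t.+1 - e); rewrite /seg.
have := lt_ie; move: ((t - i) %/ q) ((t.+1 - i) %/ q) ((t - e) %/ q) ((t.+1 - e) %/ q).
by case: (ltnP t i) => ?; case: (ltnP t.+1 i) => ?;
   case: (ltnP t e) => ?; case: (ltnP t.+1 e) => ? //; lia.
Qed.

Lemma ltn_segq t : seg t < seg (t + q).
Proof.
have h a : a <= t -> (t + q - a) %/ q = ((t - a) %/ q).+1.
  by move=> at_; rewrite -addnBAC // divnDr // divnn q0 addn1.
have := @seg_mid t; rewrite /seg; have := h i; have := h e.
have := lt_ie; move: ((t - i) %/ q) ((t + q - i) %/ q) ((t - e) %/ q) ((t + q - e) %/ q).
by case: (ltnP t i) => ?; case: (ltnP (t + q) i) => ?;
   case: (ltnP t e) => ?; case: (ltnP (t + q) e) => ? //; lia.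
Qed.

Lemma seg_homo s t : s <= t -> seg s <= seg t.
Proof.
move/subnKC <-; elim: (t - s) => [|n IH]; first by rewrite addn0.
by rewrite addnS (leq_trans IH) ?leq_seg.
Qed.

Lemma seg_eq0 t : (seg t == 0) = (t < i).
Proof. by rewrite /seg; do 2 case: ltnP => //. Qed.

Lemma seg_eqS t : (seg t == g.+1) = (i + g * q <= t < e).
Proof.
have := @seg_mid t; have : (g <= (t - i) %/ q) = (g * q <= t - i) by rewrite leq_divRL.
by rewrite /seg; case: (ltnP t i) => ?; case: (ltnP t e) => ?; lia.
Qed.

(** The segments [[0, i)] and [[i + g * q, e)] together hold more than [q] elements, so at most
    [(m - 1) * q] of the [m * q + 1] elements remain and [m + 1] segments suffice in all. *)
Lemma seg_last m : g.+2 <= m -> seg (m * q) <= m.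
Proof.
move=> gm; have : (m * q - e) %/ q <= m - g - 2.
  by rewrite -ltnS ltn_divLR //; nia.
have := @seg_mid (m * q); rewrite /seg.
by case: (ltnP (m * q) i) => ?; case: (ltnP (m * q) e) => ?; lia.
Qed.

End Segments.

Section IndicatorSums.
Local Open Scope ring_scope.
Variable R : nzRingType.

Lemma sum_indicator (a c n : nat) (F : nat -> R) : (c <= n)%N ->
  \sum_(0 <= s < n) (a <= s < c)%N%:R * F s = \sum_(a <= s < c) F s.
Proof.
move=> cn; rewrite [RHS](big_nat_widen _ _ n) // [RHS](big_nat_widenl _ 0) //.
rewrite [RHS]big_mkcond /=; apply: eq_bigr => s _.
by rewrite andbC; case: (_ && _); rewrite ?mul1r ?mul0r.
Qed.

Lemma sum_delta (a n : nat) (F : nat -> R) : (a < n)%N ->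
  \sum_(0 <= s < n) (s == a)%:R * F s = F a.
Proof.
move=> an; have := @sum_indicator a a.+1 n F an; rewrite big_nat1 => <-.
by apply: eq_bigr => s _; congr (_%:R * _); congr nat_of_bool; lia.
Qed.

End IndicatorSums.

(** * Exchanges between tight partitions *)

Section Annihilator.
Local Open Scope ring_scope.
Variables (R : realFieldType) (q m : nat).
Hypotheses (q2 : (2 <= q)%N) (m2 : (2 <= m)%N).
Let k := (m * q + 1)%N.

Lemma lt_2q_k : (2 * q < k)%N. Proof. by rewrite /k; nia. Qed.

Definition lab_tight (lab : nat -> nat) :=
  load q k (fun i => lab (i %% k)%N) = m.+1.

(** [A i j] is the coefficient of the edge between [i] and [j] modulo [k]. The double sum in
    [A_tight] counts every edge twice, and [x] rotates the labelling. *)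
Variables (A : nat -> nat -> R) (b : R).
Hypothesis A_sym : forall i j, A i j = A j i.
Hypothesis A_per : forall i j, A (i + k)%N j = A i j.
Hypothesis A_tight : forall (lab : nat -> nat) (x : nat), lab_tight lab ->
  \sum_(0 <= s < k) \sum_(0 <= t < k) (lab s == lab t)%:R * A (x + s)%N (x + t)%N = b.

Lemma A_per' i j : A i (j + k)%N = A i j.
Proof. by rewrite A_sym A_per. Qed.

Lemma tight_of_weight (lab w : nat -> nat) (c : bool) :
  (forall i, i.+1 < k -> w i <= w i.+1 /\ (lab i <> lab i.+1 -> w i < w i.+1))%N ->
  (forall i, i + q < k -> lab i = lab (i + q) -> c /\ i = 0)%N ->
  (forall i, i < q -> lab i <> lab (i + (k - q)))%N ->
  (w (m * q)%N + c <= m + w 0)%N -> lab_tight lab.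
Proof.
have kq := lt_2q_k => h1 h2 h3 h4; have h i : (i < k -> i %% k = i)%N by apply: modn_small.
apply/eqP; rewrite eqn_leq (@load_of_weight _ _ _ _ _ _ w c) //=.
- have := @load_ge _ q k (fun i => lab (i %% k)%N).
  have -> : ((k + q.-1) %/ q)%N = m.+1.
    by rewrite (_ : k + q.-1 = m.+1 * q)%N ?mulnK //; rewrite /k; lia.
  by apply; [move=> i; rewrite modnDr | lia].
- by move=> i; rewrite modnDr.
- lia.
- by move=> i ik; rewrite !h //; [apply: h1 | lia].
- by move=> i ik; rewrite !h //; [apply: h2 | lia].
- by move=> i ik; rewrite !h //; [apply: h3 | lia | lia].
- by rewrite (_ : k.-1 = m * q)%N //; rewrite /k; lia.
Qed.

(** Subtracting the equations of two tight labellings leaves a symmetrised product of [f] and [g],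
    whose two halves agree by the symmetry of [A]. *)
Lemma product_of_tight (lab lab' : nat -> nat) (f g : nat -> R) (x : nat) :
  lab_tight lab -> lab_tight lab' ->
  (forall s t, (s < k)%N -> (t < k)%N ->
    (lab s == lab t)%:R - (lab' s == lab' t)%:R = f s * g t + f t * g s) ->
  \sum_(0 <= s < k) \sum_(0 <= t < k) f s * g t * A (x + s)%N (x + t)%N = 0.
Proof.
move=> h1 h2 hfg.
have : \sum_(0 <= s < k) \sum_(0 <= t < k)
    (f s * g t + f t * g s) * A (x + s)%N (x + t)%N = 0.
  rewrite -[RHS](subrr b) -{1}(A_tight x h1) -(A_tight x h2) -sumrB.
  apply: eq_big_nat => s /= sk; rewrite -sumrB; apply: eq_big_nat => t /= tk.
  by rewrite -hfg // mulrBl.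
rewrite (eq_bigr (fun s => \sum_(0 <= t < k) f s * g t * A (x + s)%N (x + t)%N +
    \sum_(0 <= t < k) f t * g s * A (x + s)%N (x + t)%N)); last first.
  by move=> s _; rewrite -big_split; apply: eq_bigr => t _; rewrite mulrDl.
rewrite big_split /= [X in _ + X]exchange_big /= [X in _ + X](_ : _ =
  \sum_(0 <= s < k) \sum_(0 <= t < k) f s * g t * A (x + s)%N (x + t)%N).
  by move/eqP; rewrite -mulr2n mulrn_eq0 /= => /eqP.
by apply: eq_bigr => s _; apply: eq_bigr => t _; rewrite A_sym.
Qed.

(** [w'] arises from [w] by merging the first segment with the one from [i + g * q] to [e]. At least
    [q] elements lie between the two on either side of the cycle, so merging creates no chord and
    keeps all cuts; the two tight partitions differ exactly by the rectangle. *)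
Lemma rectangle0 (i g j x : nat) :
  (0 < g)%N -> (g.+2 <= m)%N -> (0 < i <= q)%N -> (0 < j <= q)%N ->
  (q < i + j)%N -> (i + g * q + j + q <= k)%N ->
  \sum_(0 <= s < i) \sum_(i + g * q <= t < i + g * q + j) A (x + s)%N (x + t)%N = 0.
Proof.
move=> g0 gm iq jq ij ek; set e := (i + g * q + j)%N in ek *.
pose w := seg q i g e; pose w' t := if w t == g.+1 then 0%N else w t.
have w_le := @leq_seg q i g e; have w_q := @ltn_segq q i g e.
have w_h := @seg_homo q i g e; have w0 := @seg_eq0 q i g e.
have wg := @seg_eqS q i g e; have wl := @seg_last q i g e.
have [q0 qk] : (0 < q)%N /\ (2 * q < k)%N by split; [lia | apply: lt_2q_k].
have {}w_le t : (w t <= w t.+1)%N by apply: w_le; rewrite // /e; lia.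
have {}w_q t : (w t < w (t + q))%N by apply: w_q; rewrite // /e; lia.
have {}w_h s t : (s <= t -> w s <= w t)%N by apply: w_h; rewrite // /e; lia.
have {}w0 t : (w t == 0%N) = (t < i)%N by apply: w0; rewrite // /e; lia.
have {}wg t : (w t == g.+1) = (i + g * q <= t < e)%N by apply: wg; rewrite // /e; lia.
have {}wl : (w (m * q) <= m)%N by apply: wl; rewrite // /e; lia.
have wrap t : (t < q)%N -> (w t < w (t + (k - q)))%N.
  by move=> tq; apply: leq_trans (w_q t) (w_h _ _ _); lia.
have t1 : lab_tight w.
  apply: (@tight_of_weight w w false) => [t _|t _ h|t /wrap h|]; last by lia.
  - by split=> //; have := w_le t; lia.
  - by have := w_q t; lia.
  - lia.
have t2 : lab_tight w'.
  apply: (@tight_of_weight w' w false) => [t _|t _|t tq|]; last by lia.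
  - split=> // h; have := w_le t; rewrite leq_eqVlt => /orP[/eqP h'|//].
    by case: h; rewrite /w' h'.
  - have := w_q t; rewrite /w'; have := wg t; have := wg (t + q)%N.
    have := w0 t; have := w0 (t + q)%N; have : (q <= g * q)%N by nia.
    move: (g * q)%N => gq.
    case: (eqVneq (w t) g.+1) => h1; case: (eqVneq (w (t + q)) g.+1) => h2; try lia.
    by have := w_q t; rewrite h1 h2 ltnn.
  - have := wrap t tq; rewrite /w'; have := wg t; have := wg (t + (k - q))%N.
    have := w0 t; have := w0 (t + (k - q))%N.
    move: (g * q)%N => gq.
    case: (eqVneq (w t) g.+1) => h1; case: (eqVneq (w (t + (k - q))%N) g.+1) => h2; lia.
have := @product_of_tight w' w (fun s => (0 <= s < i)%N%:R)
  (fun t => (i + g * q <= t < e)%N%:R) x t2 t1.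
rewrite (eq_bigr (fun s => (0 <= s < i)%N%:R *
    \sum_(i + g * q <= t < e) A (x + s)%N (x + t)%N)); last first.
  move=> s _; rewrite -(@sum_indicator _ (i + g * q) e k); last by lia.
  by rewrite mulr_sumr; apply: eq_bigr => t _; rewrite mulrA.
rewrite sum_indicator; last by rewrite /e in ek; lia.
apply=> s t sk tk; rewrite leq0n /= -!w0 -!wg /w'.
have [es|es] := eqVneq (w s) g.+1; have [et|et] := eqVneq (w t) g.+1;
  rewrite ?es ?et ?eqxx /= ?[g.+1 == w _]eq_sym ?(negbTE es) ?(negbTE et) /=;
  rewrite ?(eq_sym 0%N); ring.
Qed.

Lemma seg0_tight (i e : nat) : (0 < i <= q)%N -> (q < e)%N -> (e <= i + q)%N ->
  lab_tight (seg q i 0 e).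
Proof.
move=> iq qe ei; pose w := seg q i 0 e.
have w_le := @leq_seg q i 0 e; have w_q := @ltn_segq q i 0 e.
have w_h := @seg_homo q i 0 e; have w0 := @seg_eq0 q i 0 e.
have wl := @seg_last q i 0 e.
have [q0 qk] : (0 < q)%N /\ (2 * q < k)%N by split; [lia | apply: lt_2q_k].
have {}w_le t : (w t <= w t.+1)%N by apply: w_le; lia.
have {}w_q t : (w t < w (t + q))%N by apply: w_q; lia.
have {}w_h s t : (s <= t -> w s <= w t)%N by apply: w_h; lia.
have {}wl : (w (m * q) <= m)%N by apply: wl; lia.
apply: (@tight_of_weight w w false) => [t _|t _ h|t tq h|]; last by lia.
- by split=> //; have := w_le t; lia.
- by have := w_q t; lia.
- by have := leq_trans (w_q t) (w_h _ (t + (k - q))%N _); rewrite -h ltnn; lia.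
Qed.

(** The vertex [p] moves from the start of the segment [[p, p + r]] to the end of [[0, p)]. All
    lengths stay at most [q], so both partitions are tight and the edges from [p] to its two sides
    balance. *)
Lemma move0 (p r x : nat) : (0 < p < q)%N -> (0 < r < q)%N -> (q <= p + r)%N ->
  \sum_(p.+1 <= t < (p + r).+1) A (x + p)%N (x + t)%N =
  \sum_(0 <= t < p) A (x + p)%N (x + t)%N.
Proof.
move=> pq rq pr; set e := (p + r).+1.
have t1 : lab_tight (seg q p 0 e) by apply: seg0_tight; lia.
have t2 : lab_tight (seg q p.+1 0 e) by apply: seg0_tight; lia.
have ek : (e <= k)%N by have := lt_2q_k; lia.
apply/eqP; rewrite -subr_eq0; apply/eqP.
have := @product_of_tight _ _ (fun s => (s == p)%:R)
  (fun t => (p.+1 <= t < e)%N%:R - (0 <= t < p)%N%:R) x t1 t2.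
rewrite (eq_bigr (fun s => (s == p)%:R * \sum_(0 <= t < k)
   ((p.+1 <= t < e)%N%:R - (0 <= t < p)%N%:R) * A (x + s)%N (x + t)%N)); last first.
  by move=> s _; rewrite mulr_sumr; apply: eq_bigr => t _; rewrite mulrA.
rewrite sum_delta; last by lia.
under eq_bigr do rewrite mulrBl.
rewrite sumrB !sum_indicator; try lia.
have segE a n : (p <= a)%N ->
    seg q a 0 e n = if (n < a)%N then 0%N else if (n < e)%N then 1%N else ((n - e) %/ q).+2.
  move=> pa; rewrite /seg; case: ltnP => // _; case: ltnP => // ne.
  by rewrite divn_small //; lia.
have pe : (p < e)%N by rewrite /e; lia.
apply=> s t sk tk; rewrite !segE // !(ltnS _ p).
case: (ltngtP s p) => sp; case: (ltngtP t p) => tp;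
  case: (ltnP s e) => se; case: (ltnP t e) => te /=; rewrite ?eqSS; try lia; ring.
Qed.

(* A segment of length [q + 1] contains one chord but saves one cut, so that the
   partition into it and segments of length [q] is tight; so is the one in which
   its first vertex is split off. *)
Lemma star0 (x : nat) : \sum_(1 <= t < q.+1) A x (x + t)%N = 0.
Proof.
have [q0 qk] : (0 < q)%N /\ (2 * q < k)%N by split; [lia | apply: lt_2q_k].
pose w := seg q 1 0 q.+1; pose w' t := maxn 1 (w t).
have t1 : lab_tight w by apply: seg0_tight; lia.
have w0 t : (w t == 0%N) = (t < 1)%N by apply: seg_eq0; lia.
have t2 : lab_tight w'.
  have w_le := @leq_seg q 1 0 q.+1; have w_q := @ltn_segq q 1 0 q.+1.
  have w_h := @seg_homo q 1 0 q.+1; have wl := @seg_last q 1 0 q.+1.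
  have {}w_le t : (w t <= w t.+1)%N by apply: w_le; lia.
  have {}w_q t : (w t < w (t + q))%N by apply: w_q; lia.
  have {}w_h s t : (s <= t -> w s <= w t)%N by apply: w_h; lia.
  have {}wl : (w (m * q) <= m)%N by apply: wl; lia.
  apply: (@tight_of_weight w' w' true) => [t _|t _|t tq|]; rewrite /w'; last 1 first.
  - by have := w0 0%N; lia.
  - by split=> //; have := w_le t; lia.
  - by have := w_q t; have := w0 t; lia.
  - have := w_h q.+1 (t + (k - q))%N; have := w_h t q.
    have -> : w q = 1%N by rewrite /w /seg ltnSn ltnNge q0 /= divn_small //; lia.
    have -> : w q.+1 = 2 by rewrite /w /seg ltnn subnn div0n.
    lia.
have := @product_of_tight w' w (fun s => (s == 0%N)%:R)
  (fun t => (1 <= t < q.+1)%N%:R) x t2 t1.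
rewrite (eq_bigr (fun s => (s == 0%N)%:R * \sum_(0 <= t < k)
   (1 <= t < q.+1)%N%:R * A (x + s)%N (x + t)%N)); last first.
  by move=> s _; rewrite mulr_sumr; apply: eq_bigr => t _; rewrite mulrA.
rewrite sum_delta; last by lia.
rewrite sum_indicator ?addn0; last by lia.
apply=> s t _ _; rewrite /w'.
have segE n : w n = if (n < 1)%N then 0%N else if (n < q.+1)%N then 1%N else ((n - q.+1) %/ q).+2.
  rewrite /w /seg; case: ltnP => // _; case: ltnP => // ne.
  by rewrite divn_small //; lia.
rewrite !segE; case: s => [|s]; case: t => [|t] //=; rewrite ?ltnS.
- ring.
- by case: ltnP => _ /=; rewrite ?maxnE /=; ring.
- by case: ltnP => _ /=; rewrite ?maxnE /=; ring.
- by case: ltnP => _; case: ltnP => _ /=; rewrite ?maxnE /= ?subn0 ?add1n; ring.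
Qed.

Local Notation P x d := (A x (x + d)%N).

Lemma P_sym x d : (d <= k)%N -> P x d = P (x + d) (k - d).
Proof. by move=> dk; rewrite A_sym -A_per' -addnA subnKC. Qed.

(** [move0] rotated by [k - p], so that [y] is the vertex moved; an edge going back by [d] has
    difference [k - d]. *)
Lemma move_star (y p r : nat) : (0 < p < q)%N -> (0 < r < q)%N -> (q <= p + r)%N ->
  \sum_(1 <= d < r.+1) P y d = \sum_(1 <= d < p.+1) P y (k - d).
Proof.
move=> pq rq pr; have kq := lt_2q_k; have := move0 (y + (k - p)) pq rq pr.
have yk : (y + (k - p) + p = y + k)%N by lia.
rewrite yk -{1}(add1n p) (_ : (p + r).+1 = r.+1 + p)%N; last lia.
rewrite big_addn addnK [X in _ = X]big_nat_rev => h; rewrite [RHS]big_add1 /=.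
transitivity (\sum_(1 <= d < r.+1) A (y + k)%N (y + (k - p) + (d + p))%N).
  by apply: eq_bigr => d _; rewrite A_per -[LHS]A_per'; congr A; lia.
rewrite h; apply: eq_big_nat => t /= tp.
by rewrite A_per; congr A; lia.
Qed.

(** For [r = q - 1] the left-hand side of [move_star] does not depend on [p]; comparing [p = d] with
    [p = d - 1] isolates the edge going back by [d]. *)
Lemma star_mid y d : (1 < d < q)%N -> P y d = 0.
Proof.
move=> dq; have kq := lt_2q_k.
suff h z : P z (k - d) = 0 by rewrite P_sym ?h //; lia.
have h1 : _ = _ := @move_star z d q.-1 ltac:(lia) ltac:(lia) ltac:(lia).
have h2 : _ = _ := @move_star z d.-1 q.-1 ltac:(lia) ltac:(lia) ltac:(lia).
move: h1; rewrite h2 (_ : d.-1.+1 = d); last lia.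
rewrite [RHS]big_nat_recr /=; last lia.
by rewrite -[LHS]addr0 => /addrI.
Qed.

Lemma P_one y : P y 1 = P 0 1.
Proof.
have kq := lt_2q_k.
have back z : P z 1 = P z (k - 1).
  have := @move_star z 1 q.-1; rewrite big_nat1 => <-; try lia.
  rewrite big_ltn; last lia.
  rewrite big_nat big1 ?addr0 // => d hd; apply: star_mid; lia.
elim: y => // y <-; rewrite back (P_sym y); last lia.
by rewrite addn1.
Qed.

Lemma P_q y : P y q = - P 0 1.
Proof.
have := star0 y; rewrite big_ltn; last lia.
rewrite big_nat_recr /=; last lia.
rewrite big_nat big1 => [|d hd]; last by apply: star_mid; lia.
by rewrite P_one add0r => /eqP; rewrite addrC addr_eq0 => /eqP.
Qed.

(** The sum in [rectangle0]. The second side starts [g * q] after the end of the first, so it stays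
    in place when the first side loses its first vertex. *)
Definition rect (g x i j : nat) : R :=
  \sum_(0 <= s < i) \sum_(0 <= t < j) A (x + s)%N (x + (i + g * q + t))%N.

Lemma rect_row g x i j : rect g x i.+1 j =
  \sum_(0 <= t < j) P x (i.+1 + g * q + t) + rect g x.+1 i j.
Proof.
rewrite /rect big_nat_recl // addn0; congr (_ + _).
apply: eq_bigr => s _; apply: eq_bigr => t _; congr A; lia.
Qed.

Lemma rect_col g x i j : rect g x i j.+1 =
  rect g x i j + \sum_(0 <= s < i) A (x + s)%N (x + (i + g * q + j))%N.
Proof.
by rewrite /rect -big_split; apply: eq_bigr => s _; rewrite big_nat_recr.
Qed.

Lemma rect_eq0 g x i j : (0 < g)%N -> (g.+2 <= m)%N -> (0 < i <= q)%N ->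
  (0 < j <= q)%N -> (q < i + j)%N -> (i + g * q + j + q <= k)%N -> rect g x i j = 0.
Proof.
move=> g0 gm iq jq ij ek; rewrite -(rectangle0 x g0 gm iq jq ij ek) /rect.
apply: eq_bigr => s _; rewrite -{2}[(i + g * q)%N]add0n [(i + g * q + j)%N]addnC.
by rewrite big_addn addnK; apply: eq_bigr => t _; congr A; lia.
Qed.

(** * Long edges for [m = 3] *)

Section FourSegmentsOnly.
Hypothesis m3 : m = 3.

Let kE : k = (3 * q + 1)%N. Proof. by rewrite /k m3. Qed.

(** For [m = 3], [rect_eq0] applies only with [g = 1] and [i + j = q + 1]. The rectangle with sides
    [i] and [q - i] is completed to such a one by a row or by a column, so both equal its
    negative. *)
Lemma row_col3 x i : (i <= q)%N ->
  \sum_(0 <= t < q - i) P x (i.+1 + 1 * q + t) =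
  \sum_(0 <= s < i) A (x.+1 + s)%N (x.+1 + 2 * q)%N.
Proof.
move=> iq; have q_gt0 : (0 < q)%N by lia.
have r0 y l : (0 < l <= q)%N -> rect 1 y l (q - l).+1 = 0.
  by move=> lq; apply: rect_eq0 => //; lia.
have h : \sum_(0 <= s < i) A (x.+1 + s)%N (x.+1 + 2 * q)%N = - rect 1 x.+1 i (q - i).
  have [->|i0] := posnP i; first by rewrite /rect !big_geq ?oppr0.
  apply/eqP; rewrite -addr_eq0 addrC; apply/eqP.
  rewrite -[RHS](r0 x.+1 i) ?i0 // rect_col; congr (_ + _).
  by apply: eq_bigr => s _; congr A; lia.
rewrite h; have [->|qi] := eqVneq i q.
  by rewrite subnn /rect big_geq // big1 ?oppr0 // => s _; rewrite big_geq.
apply/eqP; rewrite -addr_eq0 -rect_row; apply/eqP.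
by rewrite (_ : q - i = (q - i.+1).+1)%N ?r0 //; lia.
Qed.

(** Compare [row_col3] for [i = d - q - 1] and for [i + 1]: the rows differ by [P (x + q) d], and
    the columns, in the other direction, by the edge from [x + d] to [x + 3q + 1], which is [x]
    modulo [k]. *)
Lemma antiperiodic3 x d : (q < d <= 2 * q)%N -> P (x + q) d = - P x d.
Proof.
move=> dq; pose i := (d - q.+1)%N.
have h2 : _ = _ := @row_col3 (x + q) i ltac:(rewrite /i; lia).
have h1 : _ = _ := @row_col3 (x + q) i.+1 ltac:(rewrite /i; lia).
move: h2; rewrite (_ : q - i = (q - i.+1).+1)%N; last by rewrite /i; lia.
rewrite [LHS]big_nat_recl // addn0.
have -> : \sum_(0 <= t < q - i.+1) P (x + q) (i.+1 + 1 * q + t.+1) =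
   \sum_(0 <= t < q - i.+1) P (x + q) (i.+2 + 1 * q + t).
  by apply: eq_bigr => t _; congr A; lia.
rewrite h1 [X in _ + X]big_nat_recr //= => h2.
move: h2; rewrite (_ : i.+1 + 1 * q = d)%N; last by rewrite /i; lia.
rewrite (_ : A ((x + q).+1 + i)%N _ = P x d); first by lra.
by rewrite A_sym -[RHS]A_per; congr A; rewrite ?kE /i; lia.
Qed.

(** Three shifts by [q] take [x + 1] to [x + k] and change the sign three times. *)
Lemma alternating3 x d : (q < d <= 2 * q)%N -> P x.+1 d = - P x d.
Proof.
move=> dq; have : P (x.+1 + q + q + q) d = P x d.
  by rewrite -[RHS]A_per -[RHS]A_per'; congr A; lia.
by rewrite !antiperiodic3 // => <-; rewrite !opprK.
Qed.

(** For even [q], a shift by [q] keeps the value by [alternating3] and negates it by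
    [antiperiodic3]. For [q = 3] the differences are 4, 5, 6 modulo 10: reversing an edge of
    difference 5 is an odd shift, 4 and 6 are complementary, and [row_col3] at [i = 0] makes the
    three values sum to 0. *)
Lemma far3 x d : q = 3 \/ ~~ odd q -> (q < d <= 2 * q)%N -> P x d = 0.
Proof.
move=> [q3|eq2] dq.
  have sx y e : (q < e <= 2 * q)%N -> P y e = P (y + e) (k - e).
    by move=> eq_; rewrite P_sym // kE; lia.
  have alt n y e : (q < e <= 2 * q)%N -> P (y + n) e = (-1) ^+ n * P y e.
    move=> eq_; elim: n => [|n IH]; first by rewrite addn0 mul1r.
    by rewrite addnS alternating3 // IH exprS mulN1r mulNr.
  have k10 : k = 10 by rewrite kE q3.
  have h5 y : P y 5 = 0.
    have := sx y 5; rewrite k10 => /(_ ltac:(lia)); rewrite alt; last by lia.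
    by rewrite /=; lra.
  have h46 y : P y 6 = P y 4.
    have := sx y 6; rewrite k10 => /(_ ltac:(lia)); rewrite alt; last by lia.
    by rewrite /=; lra.
  have := row_col3 x (i := 0); rewrite [RHS]big_geq // subn0 => /(_ (leq0n _)).
  rewrite {1}q3 !big_nat_recl // big_geq //= q3 h5 h46 => h4.
  have {}h4 : P x 4 = 0 by move: h4; rewrite !addn0 /=; lra.
  have : [|| d == 4, d == 5 | d == 6] by lia.
  by case/or3P => /eqP ->; rewrite ?h5 ?h46 ?h4.
have alt n y : P (y + n) d = (-1) ^+ n * P y d.
  elim: n => [|n IH]; first by rewrite addn0 mul1r.
  by rewrite addnS alternating3 // IH exprS mulN1r mulNr.
have := alt q x; rewrite antiperiodic3 // -signr_odd (negbTE eq2); lra.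
Qed.

End FourSegmentsOnly.

(** * Long edges for [m >= 4] *)

Section ManySegments.
Hypothesis m4 : (4 <= m)%N.

Section OneGap.
Variable g : nat.
Hypotheses (g0 : (0 < g)%N) (gm : (g + 3 <= m)%N).

(** A gap with [g <= m - 3] leaves room for two sides of length [q], so that [i] and [j] can vary
    independently as long as [q < i + j]. *)
Lemma rect4 x i j : (0 < i <= q)%N -> (0 < j <= q)%N -> (q < i + j)%N ->
  rect g x i j = 0.
Proof.
move=> iq jq ij; apply: rect_eq0 => //; first lia.
have -> : k = ((m - g - 3 + g + 3) * q + 1)%N by rewrite /k; congr (_ * _ + _)%N; lia.
by rewrite !mulnDl; move: ((m - g - 3) * q)%N (g * q)%N => a c; lia.
Qed.

Lemma strip4 x i : (0 < i < q)%N ->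
  \sum_(0 <= t < q - i + 1) P x (i.+1 + g * q + t) = 0.
Proof.
move=> iq; have := rect_row g x i (q - i + 1); rewrite !rect4; try lia.
by rewrite addr0 => <-.
Qed.

(** The strips for [r - 1] and [r] both end at the difference [g * q + q + 1]; only the former
    contains [g * q + r]. *)
Lemma inner4 x r : (1 < r < q)%N -> P x (g * q + r) = 0.
Proof.
move=> rq; have h1 : _ = _ := @strip4 x r ltac:(lia).
have h2 : _ = _ := @strip4 x r.-1 ltac:(lia).
move: h2; rewrite (_ : q - r.-1 + 1 = (q - r + 1).+1)%N; last by lia.
rewrite (_ : r.-1.+1 = r) ?big_nat_recl //; last by lia.
have -> : \sum_(0 <= t < q - r + 1) P x (r + g * q + t.+1) =
   \sum_(0 <= t < q - r + 1) P x (r.+1 + g * q + t).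
  by apply: eq_bigr => t _; congr A; lia.
by rewrite h1 addr0 addn0 [(r + _)%N]addnC.
Qed.

Lemma last_pair4 x : P x (g * q + q) + P x (g * q + q + 1) = 0.
Proof.
have := @strip4 x q.-1; rewrite (_ : q - q.-1 + 1 = 2)%N; last by lia.
move=> /(_ ltac:(lia)); rewrite !big_nat_recl // big_geq // addr0 => <-.
by congr (A _ _ + A _ _); lia.
Qed.

(** A single vertex against a full side of length [q] is a vanishing rectangle, in which [inner4]
    leaves the first and last terms. *)
Lemma first_last4 x : P x (g * q + 1) + P x (g * q + q) = 0.
Proof.
have := rect_row g x 0 q; rewrite rect4; try lia.
rewrite [X in _ + X]/rect [X in _ + X]big_geq // addr0.
rewrite big_ltn; last by lia.
rewrite (_ : q = q.-1.+1)%N; last by lia.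
rewrite [in X in _ + X]big_nat_recr /=; last by lia.
rewrite big_nat big1 ?add0r => [->|t ht].
  by congr (A _ _ + A _ _); lia.
by rewrite -(@inner4 x t.+1); [congr A; lia | lia].
Qed.

(* Comparing this with [last_pair4] shows that [P x (g * q + q)] is independent
   of [x]. *)
Lemma diagonal4 x : P x.+1 (g * q + q) + P x (g * q + q + 1) = 0.
Proof.
have := rect_col g x 2 q.-1; rewrite !rect4; try lia.
rewrite add0r !big_nat_recl // big_geq // addr0 => ->.
by rewrite addrC; congr (A _ _ + A _ _); lia.
Qed.

End OneGap.

(** The difference [(g + 1) * q + 1] occurs in [last_pair4] for [g] and in [first_last4] for
    [g + 1]; this carries the value from [g] to [g + 1]. *)
Lemma last4 g x : (0 < g)%N -> (g + 3 <= m)%N -> P x (g * q + q) = P 0 (2 * q).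
Proof.
elim: g x => // -[_ x _ m4'|g IH x _ gm].
  rewrite mul1n addnn -mul2n.
  elim: x => // x <-; have := @last_pair4 1 isT m4' x; have := @diagonal4 1 isT m4' x.
  by rewrite mul1n addnn -mul2n; lra.
have := @first_last4 g.+2 isT gm x.
have := @last_pair4 g.+1 isT ltac:(lia) x.
rewrite (IH x) //; last by lia.
rewrite (_ : g.+1 * q + q + 1 = g.+2 * q + 1)%N; last by rewrite !mulSn; lia.
lra.
Qed.

(* [(m - 2) * q + 1] and [2 * q] are complementary differences modulo [k], but
   the coefficients for them are opposite. *)
Lemma twoq4 : P 0 (2 * q) = 0.
Proof.
have := @last_pair4 (m - 3) ltac:(lia) ltac:(lia) 0%N; rewrite last4; try lia.
have d : ((m - 3) * q + q + 1 + 2 * q = k)%N.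
  by rewrite /k -[in RHS](subnK (ltnW m4)) mulnDl; lia.
rewrite (@P_sym 0 ((m - 3) * q + q + 1)); last by lia.
rewrite (_ : k - ((m - 3) * q + q + 1) = 1 * q + q)%N; last by lia.
rewrite last4 //; lra.
Qed.

Lemma far4_low x d : (q < d <= (m - 2) * q + 1)%N -> P x d = 0.
Proof.
move=> dq; have dE := divn_eq d.-1 q; have rq : (d.-1 %% q < q)%N by rewrite ltn_mod; lia.
set g := (d.-1 %/ q)%N in dE; set r := (d.-1 %% q)%N in dE rq.
have g0 : (0 < g)%N by nia.
have {}dE : d = (g * q + r.+1)%N by lia.
have [gm|gm] := leqP (g + 3) m.
  have h1 := first_last4 g0 gm x; rewrite last4 // twoq4 addr0 in h1.
  have h2 := last4 x g0 gm; rewrite twoq4 in h2.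
  have := @inner4 g g0 gm x r.+1; rewrite -dE.
  have [r0|r0] := posnP r; first by rewrite -h1 dE r0.
  have [rq1|rq1] := eqVneq r.+1 q; first by rewrite -h2 dE rq1.
  by apply; lia.
have gE : g = (m - 2)%N by nia.
have r0 : r = 0%N by rewrite gE in dE; lia.
have := @last_pair4 (m - 3) ltac:(lia) ltac:(lia) x; rewrite last4; try lia.
rewrite twoq4 add0r => <-; congr A; rewrite dE r0 gE.
by rewrite (_ : m - 2 = (m - 3).+1)%N ?mulSn; lia.
Qed.

Lemma far4 x d : (q < d < k - q)%N -> P x d = 0.
Proof.
move=> dq; have [h|h] := leqP d ((m - 2) * q + 1); first by apply: far4_low; lia.
rewrite P_sym ?far4_low //; last by lia.
have : ((m - 2) * q + 2 * q + 1 = k)%N by rewrite -mulnDl /k; congr (_ * _ + _)%N; lia.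
have : (2 * q <= (m - 2) * q)%N by rewrite leq_mul2r; lia.
lia.
Qed.

End ManySegments.

Hypothesis m3q : m = 3 -> q = 3 \/ ~~ odd q.

Lemma annihilator_values x d : (0 < d < k)%N ->
  P x d = P 0 1 * ((d == 1%N)%:R + (d == k - 1)%N%:R - (d == q)%:R - (d == k - q)%N%:R).
Proof.
have kq := lt_2q_k => dk.
have low y e : (0 < e <= q)%N -> P y e = P 0 1 * ((e == 1%N)%:R - (e == q)%:R).
  move=> eq_; have [->|e1] := eqVneq e 1%N.
    by rewrite P_one (_ : 1%N == q = false)%N ?subr0 ?mulr1 //; lia.
  have [->|eq'] := eqVneq e q; first by rewrite P_q sub0r mulrN1.
  by rewrite star_mid ?subrr ?mulr0 //; lia.
have [dq|dq] := leqP d q.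
  rewrite low //; last by lia.
  rewrite (_ : (d == k - 1)%N = false); last by lia.
  by rewrite (_ : (d == k - q)%N = false) ?addr0 ?subr0 //; lia.
have [dq'|dq'] := leqP (k - q) d.
  have -> : (d == 1%N) = false by lia.
  have -> : (d == q) = false by lia.
  rewrite (@P_sym x d) ?(low (x + d)%N (k - d)%N); [ | by lia | by lia].
  have -> : (k - d == 1)%N = (d == k - 1)%N by lia.
  have -> : (k - d == q)%N = (d == k - q)%N by lia.
  by rewrite subr0 add0r.
have -> : P x d = 0.
  have [m2'|m2'] := eqVneq m 2; first by exfalso; rewrite /k m2' in dq'; lia.
  have [m3|m3] := eqVneq m 3; last by apply: far4; lia.
  by apply: far3 => //; [apply: m3q | rewrite /k m3 in dq'; lia].
have -> : (d == 1%N) = false by lia.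
have -> : (d == q) = false by lia.
have -> : (d == k - 1)%N = false by lia.
have -> : (d == k - q)%N = false by lia.
by rewrite addr0 !subr0 mulr0.
Qed.

End Annihilator.

(** * Affine rank and facets *)

Section AffineRank.
Local Open Scope ring_scope.
Variables (R : realType) (I : finType).
Local Notation U := {ffun I -> R^o}.
Local Notation N := #|I|.
Implicit Types (a x : U) (b c : R).

Definition dot a x : R := \sum_e a e * x e.

Definition delta (e : I) : U := [ffun e' => (e' == e)%:R].

Lemma dot_delta a e : dot a (delta e) = a e.
Proof.
rewrite /dot (bigD1 e) //= ffunE eqxx mulr1 big1 ?addr0 // => e' ne.
by rewrite ffunE (negbTE ne) mulr0.
Qed.

(** Homogeneous coordinates: a point [x] becomes [pair_row x 1], and [dot a x = b] becomes
    orthogonality to [pair_row a (- b)]. *)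
Definition pair_row x c : 'rV[R]_(N + 1) :=
  row_mx (\row_j (x (enum_val j) : R)) (const_mx c).

Lemma pair_row_surj (v : 'rV[R]_(N + 1)) : exists x c, v = pair_row x c.
Proof.
exists [ffun e => lsubmx v 0 (enum_rank e)], (rsubmx v 0 0).
rewrite -[LHS]hsubmxK; congr row_mx; apply/rowP => j.
  by rewrite [RHS]mxE ffunE enum_valK.
by rewrite [RHS]mxE (ord1 j).
Qed.

Lemma sum_enum_val (F : I -> R) : \sum_(j < N) F (enum_val j) = \sum_e F e.
Proof. by rewrite [RHS](reindex _ (onW_bij _ (@enum_val_bij I))). Qed.

Lemma pair_row_mul x c a b :
  pair_row x c *m (pair_row a b)^T = const_mx (dot a x + c * b).
Proof.
rewrite /pair_row tr_row_mx mul_row_col; apply/matrixP => i j.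
rewrite !mxE big_ord1 !mxE; congr (_ + _); rewrite /dot -sum_enum_val.
by apply: eq_bigr => l _; rewrite !mxE mulrC.
Qed.

Lemma pair_row_eq0 x c : pair_row x c = 0 -> x = 0 /\ c = 0.
Proof.
move=> h; split; last first.
  by move/(congr1 (fun v : 'rV_(N + 1) => rsubmx v 0 0)): h; rewrite row_mxKr linear0 !mxE.
apply/ffunP => e; move/(congr1 (fun v : 'rV_(N + 1) => lsubmx v 0 (enum_rank e))): h.
by rewrite row_mxKl linear0 !mxE enum_rankK ffunE.
Qed.

Lemma pair_row0 : pair_row 0 0 = 0.
Proof.
rewrite /pair_row -[RHS]row_mx0; congr row_mx; apply/rowP => j; rewrite !mxE //.
by rewrite ffunE.
Qed.

Lemma pair_rowD x c x' c' : pair_row x c + pair_row x' c' = pair_row (x + x') (c + c').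
Proof.
rewrite /pair_row add_row_mx; congr row_mx; apply/rowP => j; rewrite !mxE //.
by rewrite ffunE.
Qed.

Lemma pair_rowZ b x c : b *: pair_row x c = pair_row (b *: x) (b * c).
Proof.
rewrite /pair_row scale_row_mx; congr row_mx; apply/rowP => j; rewrite !mxE //.
by rewrite ffunE.
Qed.

Lemma pair_row_sum n (d : 'I_n -> R) (p : 'I_n -> U) :
  \sum_i d i *: pair_row (p i) 1 = pair_row (\sum_i d i *: p i) (\sum_i d i).
Proof.
elim/big_rec3: _ => [|i x c v _ ->]; first by rewrite pair_row0.
by rewrite pair_rowZ pair_rowD mulr1.
Qed.

Definition points_mx n (p : 'I_n -> U) : 'M[R]_(n, N + 1) :=
  \matrix_(i < n) pair_row (p i) 1.

Lemma affinely_independentE n (p : 'I_n -> U) :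
  affinely_independent p <-> row_free (points_mx p).
Proof.
have mulE (v : 'rV[R]_n) : v *m points_mx p =
    pair_row (\sum_i v 0 i *: p i) (\sum_i v 0 i).
  by rewrite mulmx_sum_row -pair_row_sum; apply: eq_bigr => i _; rewrite rowK.
split=> [h|h c c0 p0 i].
  apply: inj_row_free => v; rewrite mulE => /pair_row_eq0[p0 c0].
  by apply/rowP => i; rewrite mxE; apply: (h (fun i => v 0 i)).
have /eqP : (\row_i c i) *m points_mx p = 0.
  rewrite mulE -[RHS]pair_row0; congr pair_row.
    by rewrite -[RHS]p0; apply: eq_bigr => j _; rewrite mxE.
  by rewrite -[RHS]c0; apply: eq_bigr => j _; rewrite mxE.
by rewrite mulmx_free_eq0 // => /eqP/rowP/(_ i); rewrite !mxE.
Qed.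

Lemma points_mx_mul0 n (p : 'I_n -> U) a b :
  points_mx p *m (pair_row a (- b))^T = 0 <-> forall i, dot a (p i) = b.
Proof.
have rowE i : row i (points_mx p *m (pair_row a (- b))^T) = const_mx (dot a (p i) - b).
  by rewrite row_mul rowK pair_row_mul mul1r.
split=> [h i|h].
  have := rowE i; rewrite h linear0 => /matrixP/(_ 0 0); rewrite !mxE => /eqP.
  by rewrite eq_sym subr_eq0 => /eqP.
by apply/row_matrixP => i; rewrite rowE h subrr linear0.
Qed.

Lemma affinely_independent_sub n (p : 'I_n -> U) :
  exists p' : 'I_(\rank (points_mx p)) -> U,
    affinely_independent p' /\ forall i, exists j, p' i = p j.
Proof.
pose f := maxrankfun (points_mx p); exists (p \o f); split; last by move=> i; exists (f i).
apply/affinely_independentE; rewrite (_ : points_mx _ = rowsub f (points_mx p)).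
  exact: maxrowsub_free.
by apply/row_matrixP => i; rewrite row_rowsub !rowK.
Qed.

Lemma leq_affine n (p : 'I_n -> U) : affinely_independent p -> (n <= N.+1)%N.
Proof.
move/affinely_independentE; rewrite /row_free => /eqP <-.
by rewrite (leq_trans (rank_leq_col _)) ?addn1.
Qed.

Lemma leq_affine1 n (p : 'I_n -> U) a b : a != 0 ->
  (forall i, dot a (p i) = b) -> affinely_independent p -> (n <= N)%N.
Proof.
move=> a0 /points_mx_mul0 h /affinely_independentE; rewrite /row_free => /eqP pn.
have := mulmx0_rank_max h; rewrite pn mxrank_tr rank_rV.
by case: eqP => [/pair_row_eq0[/eqP]|_]; rewrite ?(negbTE a0) //=; lia.
Qed.

(** The vectors [y] and [y'] certify, by a triangular system, that [a] and [a'] are linearly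
    independent; the two equations lower the rank by two. *)
Lemma leq_affine2 n (p : 'I_n -> U) a b a' b' y y' :
  dot a y != 0 -> dot a' y = 0 -> dot a' y' != 0 ->
  (forall i, dot a (p i) = b) -> (forall i, dot a' (p i) = b') ->
  affinely_independent p -> (n < N)%N.
Proof.
move=> ay a'y a'y' /points_mx_mul0 h /points_mx_mul0 h' /affinely_independentE.
rewrite /row_free => /eqP pn.
pose K := row_mx (pair_row a (- b))^T (pair_row a' (- b'))^T.
have hK : points_mx p *m K = 0 by rewrite mul_mx_row h h' row_mx0.
have : \rank K = 2.
  rewrite -mxrank_tr; apply/eqP; apply: inj_row_free => v.
  rewrite /K tr_row_mx !trmxK -[v]hsubmxK mul_row_col.
  rewrite [lsubmx v]mx11_scalar [rsubmx v]mx11_scalar !mul_scalar_mx !pair_rowZ pair_rowD.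
  set c := lsubmx v 0 0; set c' := rsubmx v 0 0 => /pair_row_eq0[e _].
  have dotE z : c * dot a z + c' * dot a' z = 0.
    transitivity (dot (c *: a + c' *: a') z); last first.
      by rewrite e /dot big1 // => i _; rewrite ffunE mul0r.
    rewrite /dot !mulr_sumr -big_split; apply: eq_bigr => i _.
    by rewrite !ffunE mulrDl !mulrA.
  have c0 : c = 0.
    by apply/eqP; have /eqP := dotE y; rewrite a'y mulr0 addr0 mulf_eq0 (negbTE ay) orbF.
  have c'0 : c' = 0.
    apply/eqP; have /eqP := dotE y'.
    by rewrite c0 mul0r add0r mulf_eq0 (negbTE a'y') orbF.
  by rewrite c0 c'0 !raddf0 row_mx0.
by have := mulmx0_rank_max hK; rewrite pn => h1 h2; rewrite h2 in h1; lia.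
Qed.

(** The equations satisfied by all points form the kernel of the transposed point matrix; bounding
    it by [K] bounds the rank from below. *)
Lemma rank_points n (p : 'I_n -> U) (t : nat) (K : 'M[R]_(t, N + 1)) :
  (forall a b, (forall i, dot a (p i) = b) -> (pair_row a (- b) <= K)%MS) ->
  (N.+1 <= \rank (points_mx p) + \rank K)%N.
Proof.
move=> h; have : (kermx (points_mx p)^T <= K)%MS.
  apply/rV_subP => v; have [a [c ->]] := pair_row_surj v; move/sub_kermxP => hv.
  rewrite -[c]opprK; apply: h; apply/points_mx_mul0.
  by rewrite opprK -[LHS]trmxK trmx_mul trmxK hv trmx0.
by move/mxrankS; rewrite mxrank_ker mxrank_tr; have := rank_leq_col (points_mx p); lia.
Qed.

Lemma affine_basis n (p : 'I_n -> U) :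
  (forall a b, (forall i, dot a (p i) = b) -> a = 0 /\ b = 0) ->
  exists p' : 'I_N.+1 -> U, affinely_independent p' /\ forall i, exists j, p' i = p j.
Proof.
move=> h; have : \rank (points_mx p) = N.+1.
  apply/eqP; rewrite eqn_leq (leq_trans (rank_leq_col _)) ?addn1 //=.
  have := @rank_points n p 1 0; rewrite mxrank0 addn0; apply=> a b /h[-> ->].
  by rewrite oppr0 pair_row0 sub0mx.
by move=> <-; apply: affinely_independent_sub.
Qed.

Lemma affine_hyperplane_basis n (p : 'I_n -> U) a0 b0 : (0 < n)%N -> a0 != 0 ->
  (forall i, dot a0 (p i) = b0) ->
  (forall a b, (forall i, dot a (p i) = b) -> exists c, a = c *: a0) ->
  exists p' : 'I_N -> U, affinely_independent p' /\ forall i, exists j, p' i = p j.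
Proof.
move=> n0 a00 h0 h; have : \rank (points_mx p) = N.
  have /points_mx_mul0 hp := h0.
  have := mulmx0_rank_max hp; rewrite mxrank_tr rank_rV.
  have -> : pair_row a0 (- b0) != 0.
    by apply/eqP => /pair_row_eq0[/eqP]; rewrite (negbTE a00).
  have : (N.+1 <= \rank (points_mx p) + \rank (pair_row a0 (- b0)))%N.
    apply: rank_points => a b hab; have [c ac] := h a b hab.
    have -> : b = c * b0.
      rewrite -(h0 (Ordinal n0)) -(hab (Ordinal n0)) ac /dot mulr_sumr.
      by apply: eq_bigr => e _; rewrite !ffunE mulrA.
    by rewrite ac -mulrN -pair_rowZ scalemx_sub.
  by rewrite rank_rV; lia.
by move=> <-; apply: affinely_independent_sub.
Qed.

Lemma has_dimension_unique (X : set U) d d' :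
  has_dimension X d -> has_dimension X d' -> d = d'.
Proof.
move=> [n [-> [p [ip Xp]] hn]] [n' [-> [p' [ip' Xp']] hn']].
by have := hn _ _ ip' Xp'; have := hn' _ _ ip Xp => h1 h2; congr (_%:Z - 1); lia.
Qed.

End AffineRank.

(** * Edge coordinates and the dimension of the polytope *)

Section Coordinates.
Local Open Scope ring_scope.
Variables (R : realType) (V : finType).
Implicit Types (a x : {ffun edge V -> R^o}) (i j u v : V) (Pi : {set {set V}}).

Lemma dotDl a a' x : dot (a + a') x = dot a x + dot a' x.
Proof. by rewrite /dot -big_split; apply: eq_bigr => e _; rewrite ffunE mulrDl. Qed.

Lemma dotZl (c : R) a x : dot (c *: a) x = c * dot a x.
Proof. by rewrite /dot mulr_sumr; apply: eq_bigr => e _; rewrite ffunE mulrA. Qed.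

Lemma dot0l x : dot 0 x = 0.
Proof. by rewrite /dot big1 // => e _; rewrite ffunE mul0r. Qed.

Lemma dotC a x : dot a x = dot x a.
Proof. by apply: eq_bigr => e _; rewrite mulrC. Qed.

Lemma dot_suml (I : Type) (r : seq I) (F : I -> {ffun edge V -> R^o}) x :
  dot (\sum_(i <- r) F i) x = \sum_(i <- r) dot (F i) x.
Proof.
elim/big_rec2: _ => [|i s y _ <-]; first exact: dot0l.
by rewrite dotDl.
Qed.

Lemma dot_sumr (I : Type) (r : seq I) (F : I -> {ffun edge V -> R^o}) a :
  dot a (\sum_(i <- r) F i) = \sum_(i <- r) dot a (F i).
Proof. by rewrite dotC dot_suml; apply: eq_bigr => i _; rewrite dotC. Qed.

Definition edge_delta u v : {ffun edge V -> R^o} :=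
  if insub [set u; v]%SET is Some e then delta R e else 0.

Lemma coord_atE x i j : @coord_at R V x i j = dot (edge_delta i j) x.
Proof.
by rewrite /coord_at /edge_delta; case: insub => [e|]; rewrite ?dot0l // dotC dot_delta.
Qed.

Lemma coord_atC x i j : @coord_at R V x i j = coord_at x j i.
Proof. by rewrite /coord_at finset.setUC. Qed.

Lemma coord_at_diag x i : @coord_at R V x i i = 0.
Proof.
rewrite /coord_at; case: insubP => // e; by rewrite finset.setUid cards1.
Qed.

Lemma coord_at_neq x i j : i != j ->
  exists2 e : edge V, val e = [set i; j]%SET & @coord_at R V x i j = x e.
Proof.
move=> ij; rewrite /coord_at; case: insubP => [e _ he|]; first by exists e.
by rewrite cards2 ij.
Qed.

Lemma eq_set2 i j u v : u != v ->
  ([set i; j] == [set u; v])%SET = (i == u) && (j == v) || (i == v) && (j == u).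
Proof.
move=> uv; apply/eqP/idP => [/finset.setP h|]; last first.
  by case/orP => /andP[/eqP -> /eqP ->] //; rewrite finset.setUC.
have := h i; have := h j; have := h u; have := h v.
rewrite !inE !eqxx ?orbT /= (eq_sym u i) (eq_sym u j) (eq_sym v i) (eq_sym v j).
have notboth w : ~~ ((w == u) && (w == v)).
  by apply/negP => /andP[/eqP -> /eqP e]; rewrite e eqxx in uv.
move: (notboth i) (notboth j).
by case: (i == u); case: (i == v); case: (j == u); case: (j == v).
Qed.

Lemma coord_edge_delta i j u v : i != j -> u != v ->
  coord_at (edge_delta u v : edge_vector R V) i j
    = ((i == u) && (j == v) || (i == v) && (j == u))%:R.
Proof.
move=> ij uv; have [e he ->] := coord_at_neq (edge_delta u v) ij.
rewrite -eq_set2 // -he /edge_delta; case: insubP => [e' _ he'|]; last by rewrite cards2 uv.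
by rewrite ffunE -he'.
Qed.

Lemma double_dot a x :
  \sum_i \sum_j coord_at (a : edge_vector R V) i j * coord_at (x : edge_vector R V) i j
    = dot a x *+ 2.
Proof.
have E i j : coord_at (a : edge_vector R V) i j * coord_at (x : edge_vector R V) i j
    = \sum_(e : edge V) ([set i; j]%SET == val e)%:R * (a e * x e).
  rewrite /coord_at; case: insubP => [e _ he|h].
    rewrite (bigD1 e) //= he eqxx mul1r big1 ?addr0 // => e' ne.
    by rewrite -he (inj_eq val_inj) eq_sym (negbTE ne) mul0r.
  rewrite mul0r big1 // => e _; case: eqP => [he|]; last by rewrite mul0r.
  by rewrite he (valP e) in h.
under eq_bigr => i _ do under eq_bigr => j _ do rewrite E.
under eq_bigr => i _ do rewrite exchange_big /=.
rewrite exchange_big /= /dot -sumrMnl; apply: eq_bigr => e _.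
have /cards2P[u [v [uv ev]]] := valP e.
transitivity (\sum_i \sum_j ((i == u)%:R * (j == v)%:R + (i == v)%:R * (j == u)%:R) * (a e * x e)).
  apply: eq_bigr => i _; apply: eq_bigr => j _; rewrite ev eq_set2 //; congr (_ * _).
  have [->|iu] := eqVneq i u; first by rewrite (negbTE uv) orbF mul0r addr0 mul1r.
  by rewrite mul0r add0r; case: (i == v); case: (j == u); rewrite /= ?mul1r ?mul0r ?mulr0.
have one (w : V) : \sum_i (i == w)%:R = 1 :> R.
  by rewrite (bigD1 w) //= eqxx big1 ?addr0 // => i /negbTE ->.
under eq_bigr => i _ do rewrite -mulr_suml big_split -!mulr_sumr !one !mulr1.
by rewrite -mulr_suml big_split /= !one mulrDl !mul1r mulr2n.
Qed.

Lemma coord_partition Pi i j : finset.partition Pi [set: V]%SET -> i != j ->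
  coord_at (partition_vector R Pi) i j = (finset.pblock Pi i == finset.pblock Pi j)%:R.
Proof.
move=> /and3P[/eqP cov triv _] ij; have [e he ->] := coord_at_neq (partition_vector R Pi) ij.
rewrite ffunE he; congr _%:R; congr nat_of_bool.
have inc w : w \in finset.cover Pi by rewrite cov inE.
rewrite finset.eq_pblock //; apply/existsP/idP => [[B /andP[BP]]|h].
  by rewrite finset.subUset !finset.sub1set => /andP[iB jB]; rewrite (finset.def_pblock triv BP iB).
exists (finset.pblock Pi i); rewrite finset.pblock_mem //=.
by rewrite finset.subUset !finset.sub1set h finset.mem_pblock inc.
Qed.

Lemma pblock_preim (T : eqType) (f : V -> T) i j :
  (finset.pblock (finset.preim_partition f [set: V]%SET) i ==
   finset.pblock (finset.preim_partition f [set: V]%SET) j)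
    = (f i == f j).
Proof.
have /and3P[/eqP cov triv _] := finset.preim_partitionP f [set: V]%SET.
rewrite finset.eq_pblock ?cov ?inE //.
by rewrite (finset.pblock_equivalence_partition (R := [rel x y | f x == f y])) ?inE //;
  split=> /= [|/eqP ->]; rewrite ?eqxx.
Qed.

(** A point of the face is a convex combination of partition vectors. The nonnegative numbers
    [w l * (b - dot phi (p l))] sum to 0, so every vector of positive weight is tight. *)
Lemma face_functional (phi : {ffun edge V -> R^o}) (b : R)
    (a : {ffun edge V -> R^o}) (c : R) :
  (forall Pi, finset.partition Pi [set: V]%SET -> dot phi (partition_vector R Pi) <= b) ->
  (forall Pi, finset.partition Pi [set: V]%SET -> dot phi (partition_vector R Pi) = b ->
     dot a (partition_vector R Pi) = c) ->
  forall x, face (@CPP R V) (dot phi) b x -> dot a x = c.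
Proof.
move=> hle htight x [[n [p [w [hp w0 w1 ->]]]] hx].
have dotE y : dot y (\sum_l w l *: p l) = \sum_l w l * dot y (p l).
  by rewrite dot_sumr; apply: eq_bigr => l _; rewrite dotC dotZl dotC.
have h0 : \sum_l w l * (b - dot phi (p l)) = 0.
  under eq_bigr do rewrite mulrBr.
  by rewrite sumrB -mulr_suml w1 mul1r -dotE hx subrr.
have ge0 l : 0 <= w l * (b - dot phi (p l)).
  by rewrite mulr_ge0 // subr_ge0; have [Pi hPi ->] := hp l; apply: hle.
have /eqP := h0; rewrite psumr_eq0 // => /allP h.
rewrite dotE -[RHS]mul1r -w1 mulr_suml; apply: eq_bigr => l _.
have := h l; rewrite mem_index_enum => /(_ isT); rewrite /= mulf_eq0 subr_eq0.
case/orP => [/eqP ->|/eqP hb]; first by rewrite !mul0r.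
by have [Pi hPi hpi] := hp l; rewrite hpi htight // -hpi hb.
Qed.

Lemma vertex_CPP Pi : finset.partition Pi [set: V]%SET -> @CPP R V (partition_vector R Pi).
Proof.
move=> hPi; exists 1%N, (fun=> partition_vector R Pi), (fun=> 1).
split=> [_|_||]; rewrite ?big_ord1 ?scale1r //; by exists Pi.
Qed.

(** An equation valid on all partition vectors is trivial: the partition into singletons gives
    [b = 0], and the one whose only larger block is the edge [e] gives [a e = 0]. *)
Lemma CPP_full_dim : has_dimension (@CPP R V) (#|edge V|.+1%:Z - 1).
Proof.
exists #|edge V|.+1; split=> //; last by move=> m p ip _; apply: leq_affine ip.
pose T := [pred Pi : {set {set V}} | finset.partition Pi [set: V]%SET].
have [|p' [ip hp]] := @affine_basis R (edge V) #|T|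
    (fun l => partition_vector R (enum_val l)); last first.
  exists p'; split=> // l; have [l' ->] := hp l.
  by apply: vertex_CPP; have := enum_valP l'.
move=> a b h.
have {}h (S : eqType) (f : V -> S) :
    dot a (partition_vector R (finset.preim_partition f [set: V]%SET)) = b.
  have hT : finset.preim_partition f [set: V]%SET \in T by apply: finset.preim_partitionP.
  by rewrite -[RHS](h (enum_rank_in hT (finset.preim_partition f [set: V]%SET))) enum_rankK_in.
have vecE (S : eqType) (f : V -> S) (e : edge V) i j : val e = [set i; j]%SET -> i != j ->
    partition_vector R (finset.preim_partition f [set: V]%SET) e = (f i == f j)%:R.
  move=> he ij; rewrite -(pblock_preim f) -coord_partition ?finset.preim_partitionP //.
  have [e' he' ->] := coord_at_neq (partition_vector R (finset.preim_partition f [set: V]%SET)) ij.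
  by congr (_ _); apply: val_inj; rewrite he he'.
have b0 : b = 0.
  rewrite -(h V id) /dot big1 // => e _; have /cards2P[i [j [ij he]]] := valP e.
  by rewrite (vecE _ _ _ i j) // (negbTE ij) mulr0.
split=> //; apply/ffunP => e; rewrite ffunE -[RHS]b0.
have /cards2P[i [j [ij he]]] := valP e.
rewrite -(h V (fun v => if v == i then j else v)) -dot_delta; congr dot.
apply/ffunP => e'; have /cards2P[i' [j' [ij' he']]] := valP e'.
rewrite (vecE _ _ _ i' j') // ffunE; congr (_%:R); congr nat_of_bool.
rewrite -(inj_eq val_inj) /= he he' eq_set2 //.
case: (eqVneq i' i) => [ei|ni]; case: (eqVneq j' i) => [ej|nj] /=.
- by rewrite ei ej eqxx in ij'.
- by rewrite ei (negbTE ij) orbF eq_sym.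
- by rewrite andbT.
- by rewrite andbF (negbTE ij').
Qed.

End Coordinates.

Lemma load_shift (T : eqType) (q k s : nat) (u : nat -> T) :
  (forall i, u (i + k) = u i) -> load q k (fun i => u (i + s)) = load q k u.
Proof.
move=> hu; rewrite /load -[in RHS](cnt_period s (cut_period hu)).
rewrite -[in RHS](cnt_period s (chord_period q hu)) /cnt.
by congr (_ + _); apply: eq_bigr => i _; rewrite /cut /chord add0n (addnC s) // addnAC.
Qed.

Lemma eq_load (T T' : eqType) (q k : nat) (u : nat -> T) (u' : nat -> T') :
  (forall i j, (u i == u j) = (u' i == u' j)) -> load q k u = load q k u'.
Proof.
move=> h; rewrite /load /cnt.
by congr (_ + _); apply: eq_bigr => i _; rewrite /cut /chord h.
Qed.

(** * The chorded cycle inequality *)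

Section CyclicIndices.
Local Open Scope ring_scope.
Variables (R : realType) (q k : nat).
Hypotheses (hq : (2 <= q)%N) (hqk : (2 * q <= k)%N).
Local Notation V := 'Z_k.
Let pt (i : nat) : V := i%:R.

Lemma k_gt1 : (1 < k)%N. Proof. by lia. Qed.

Lemma pt_eq i j : (pt i == pt j) = (i == j %[mod k])%N.
Proof. by rewrite -(inj_eq val_inj) /= !val_Zp_nat // k_gt1. Qed.

Lemma pt_per i : pt (i + k) = pt i.
Proof. by apply/eqP; rewrite pt_eq modnDr. Qed.

Lemma ptD i j : pt i + pt j = pt (i + j). Proof. by rewrite /pt natrD. Qed.

Lemma pt_neq i d : (0 < d < k)%N -> pt i != pt (i + d).
Proof.
move=> dk; rewrite pt_eq eq_sym -[X in (_ == X %[mod k])%N]addn0 eqn_modDl mod0n modn_small; lia.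
Qed.

Lemma sum_pt (F : V -> R) : \sum_z F z = \sum_(0 <= i < k) F (pt i).
Proof.
rewrite /pt; move: k_gt1 F; clear; case: k => [|[|n]] // _ F.
by rewrite big_mkord; apply: eq_bigr => i _; rewrite natr_Zp.
Qed.

Lemma sum_pt_shift x (F : V -> R) : \sum_z F z = \sum_(0 <= i < k) F (pt (x + i)).
Proof.
rewrite sum_pt -(@big_shift_period _ _ +%R k x (fun i => F (pt i))) /=.
  by apply: eq_bigr => i _; rewrite addnC.
by move=> i; rewrite pt_per.
Qed.

Definition phi : {ffun edge V -> R^o} :=
  \sum_(z : V) (edge_delta R z (z + 1) + (-1) *: edge_delta R z (z + q%:R)).

Lemma lhsE : @chorded_cycle_lhs R q k = dot phi.
Proof.
apply/funext => x; rewrite /phi dot_suml; apply: eq_bigr => z _.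
by rewrite dotDl dotZl mulN1r !coord_atE.
Qed.

Lemma lhs_pt (x : edge_vector R V) :
  dot phi x = \sum_(0 <= i < k)
    (coord_at x (pt i) (pt (i + 1)) - coord_at x (pt i) (pt (i + q))).
Proof.
by rewrite -lhsE /chorded_cycle_lhs sum_pt; apply: eq_bigr => i _; rewrite -!ptD.
Qed.

Lemma rhsE : chorded_cycle_rhs R q k = k%:R - ((k + q.-1) %/ q)%N%:R.
Proof.
rewrite /chorded_cycle_rhs; congr (_ - _).
rewrite (ceil_def (m := Posz ((k + q.-1) %/ q)%N)) //.
have q0 : 0 < q%:R :> R by rewrite ltr0n; lia.
have := divn_eq (k + q.-1) q; have := ltn_pmod (k + q.-1) (ltnW hq).
set C := (_ %/ _)%N; set r := (_ %% _)%N => rq e.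
rewrite ltr_pdivlMr // ler_pdivrMr // intrB /= -[_%:~R]/(C%:R : R) mulrBl mul1r ltrBlDr.
by rewrite -!natrM -natrD ltr_nat ler_nat; lia.
Qed.

Definition label (Pi : {set {set V}}) (i : nat) : {set V} := finset.pblock Pi (pt i).

Lemma label_per Pi i : label Pi (i + k) = label Pi i.
Proof. by rewrite /label pt_per. Qed.

Lemma coord_label Pi i d : finset.partition Pi [set: V]%SET -> (0 < d < k)%N ->
  coord_at (partition_vector R Pi) (pt i) (pt (i + d)) = (label Pi i == label Pi (i + d)%N)%:R.
Proof. by move=> hPi dk; rewrite coord_partition // pt_neq. Qed.

Lemma lhs_load Pi : finset.partition Pi [set: V]%SET ->
  dot phi (partition_vector R Pi) = k%:R - (load q k (label Pi))%:R.
Proof.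
move=> hPi; rewrite lhs_pt /load natrD /cnt !natr_sum opprD addrA.
have -> : k%:R = \sum_(0 <= i < k) 1 :> R by rewrite sumr_const_nat subn0.
rewrite -!sumrB; apply: eq_bigr => i _.
rewrite !coord_label //; try lia.
rewrite /cut /chord !add0n addn1; congr (_ - _).
by case: (_ == _); rewrite /= ?subrr ?subr0.
Qed.

Lemma lhs_le Pi : finset.partition Pi [set: V]%SET ->
  dot phi (partition_vector R Pi) <= chorded_cycle_rhs R q k.
Proof.
move=> hPi; rewrite lhs_load // rhsE lerD2l lerN2 ler_nat.
by apply: load_ge; [apply: label_per | lia].
Qed.

Lemma lhs_eq Pi : finset.partition Pi [set: V]%SET ->
  dot phi (partition_vector R Pi) = chorded_cycle_rhs R q k <->
  load q k (label Pi) = ((k + q.-1) %/ q)%N.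
Proof.
move=> hPi; rewrite lhs_load // rhsE; split=> [/addrI/oppr_inj/eqP|->] //.
by rewrite eqr_nat => /eqP.
Qed.

Lemma coord_pt_delta (e d i : nat) : (0 < e < k)%N -> (0 < d < k)%N -> (i < k)%N ->
  coord_at (edge_delta R (pt 0) (pt e) : edge_vector R V) (pt i) (pt (i + d))
   = ((i == 0%N) && (d == e) || (i == e) && (d == k - e)%N)%:R.
Proof.
move=> he hd hi; have e0 : pt 0 != pt e := pt_neq 0 he.
have [he1 he2] := andP he; have [hd1 hd2] := andP hd.
rewrite coord_edge_delta ?pt_neq // !pt_eq mod0n !(modn_small he2) !(modn_small hi).
congr (nat_of_bool (_ || _))%:R.
  by case: eqP => // ->; rewrite add0n modn_small.
case: eqP => // ->; rewrite /=; have [h|h] := ltnP (e + d)%N k.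
  by rewrite modn_small //; lia.
by rewrite -(subnK h) modnDr modn_small; lia.
Qed.

(* Only the edge {0, 1} of the test vector contributes: it is a cycle edge and no
   chord. *)
Lemma lhs_delta : dot phi (edge_delta R (pt 0) (pt 1)) = 1.
Proof.
rewrite lhs_pt big_ltn; last by lia.
rewrite !coord_pt_delta; try lia.
rewrite big_nat big1 => [|i hi]; rewrite ?addr0.
  by rewrite !eqxx (_ : (q == 1)%N = false) ?andbF ?subr0 //; lia.
rewrite !coord_pt_delta; try lia.
have -> : (i == 0)%N = false by lia.
have -> : (1 == k - 1)%N = false by lia.
have -> : (q == k - 1)%N = false by lia.
by rewrite !andbF subrr.
Qed.

Lemma phi_neq0 : phi != 0.
Proof. by apply/eqP => h; have := lhs_delta; rewrite h dot0l => /eqP; rewrite eq_sym oner_eq0. Qed.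

(** A facet has [#|edge V|] affinely independent points. Here [a] vanishes on the face and is
    independent of [phi]: it is nonzero at [y], but 0 on the edge [{0, 1}], where [phi] is 1. *)
Lemma not_facet (a : {ffun edge V -> R^o}) (y : {ffun edge V -> R^o}) :
  dot a (edge_delta R (pt 0) (pt 1)) = 0 -> dot a y != 0 ->
  (forall Pi, finset.partition Pi [set: V]%SET ->
     load q k (label Pi) = ((k + q.-1) %/ q)%N -> dot a (partition_vector R Pi) = 0) ->
  ~ induces_facet (@CPP R V) (@chorded_cycle_lhs R q k) (chorded_cycle_rhs R q k).
Proof.
move=> a1 ay htight; rewrite lhsE => -[_ [d [hd hf]]].
have dE := has_dimension_unique hd (CPP_full_dim R V).
have [n [nE [p [ip hp]] _]] := hf.
have : (n < #|edge V|)%N.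
  apply: (leq_affine2 (y := edge_delta R (pt 0) (pt 1)) (y' := y)
    (a := phi) (a' := a) (b := chorded_cycle_rhs R q k) (b' := 0)) ip.
  - by rewrite lhs_delta oner_neq0.
  - exact: a1.
  - exact: ay.
  - by move=> i; have [] := hp i.
  - move=> i; apply: face_functional (hp i); first exact: lhs_le.
    by move=> Pi hPi /lhs_eq h; apply: htight => //; apply: h.
by move: nE; rewrite dE; lia.
Qed.

Lemma not_facet_of_mod : (k != 1 %[mod q])%N ->
  ~ induces_facet (@CPP R V) (@chorded_cycle_lhs R q k) (chorded_cycle_rhs R q k).
Proof.
move=> kq; have hq1 : (1 %% q = 1)%N by rewrite modn_small.
(* The second equation is [x_{0,q} = 0], by [tight_chord_free]. *)
apply: (@not_facet (edge_delta R (pt 0) (pt q)) (edge_delta R (pt 0) (pt q))).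
- rewrite -coord_atE -[pt q]/(pt (0 + q)) coord_pt_delta; try lia.
  by rewrite (_ : (q == 1)%N = false) //; lia.
- rewrite -[X in dot X]/(edge_delta R (pt 0) (pt (0 + q))) -coord_atE.
  by rewrite coord_pt_delta ?eqxx ?oner_neq0 //; lia.
move=> Pi hPi hl; rewrite -coord_atE -[pt q]/(pt (0 + q)) coord_label //; last by lia.
have := @tight_chord_free _ q k (label Pi) (label_per Pi) 0 hq.
by rewrite /chord => -> //; [lia | rewrite hq1 in kq].
Qed.

Lemma not_facet_of_odd : k = (3 * q + 1)%N -> odd q -> q != 3 ->
  ~ induces_facet (@CPP R V) (@chorded_cycle_lhs R q k) (chorded_cycle_rhs R q k).
Proof.
move=> kE oq q3; have q5 : (5 <= q)%N by move: q3 oq hq; case: (q) => [|[|[|[|[|]]]]].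
pose a : {ffun edge V -> R^o} :=
  \sum_(0 <= i < k) (-1) ^+ i *: edge_delta R (pt i) (pt (i + (q + 2))).
have aE x : dot a x = \sum_(0 <= i < k) (-1) ^+ i *
    coord_at (x : edge_vector R V) (pt i) (pt (i + (q + 2))).
  by rewrite dot_suml; apply: eq_bigr => i _; rewrite dotZl coord_atE.
apply: (@not_facet a (edge_delta R (pt 0) (pt (q + 2)))).
- rewrite aE big_nat big1 // => i hi; rewrite coord_pt_delta; try lia.
  have -> : (q + 2 == 1)%N = false by lia.
  have -> : (q + 2 == k - 1)%N = false by lia.
  by rewrite !andbF mulr0.
- rewrite aE big_ltn; last by lia.
  rewrite coord_pt_delta ?eqxx; try lia.
  rewrite big_nat big1 => [|i hi].
    by rewrite mul1r addr0 oner_neq0.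
  rewrite coord_pt_delta; try lia.
  have -> : (i == 0)%N = false by lia.
  (* From its other end the edge has difference [k - (q + 2) = 2q - 1], which equals [q + 2] only
     for [q = 3]. *)
  have -> : (q + 2 == k - (q + 2))%N = false by lia.
  by rewrite andbF mulr0.
move=> Pi hPi hl; rewrite aE -[RHS](@alternating_sum R _ q k (label Pi) (label_per Pi)) //.
  by apply: eq_big_nat => i hi; rewrite coord_label //; lia.
by rewrite hl kE (_ : 3 * q + 1 + q.-1 = 4 * q)%N ?mulnK //; lia.
Qed.

(** By [annihilator_values], every equation valid on the tight partition vectors is a multiple of
    [phi]; [affine_hyperplane_basis] then yields [#|edge V|] affinely independent points of the
    face, and [leq_affine1] bounds their number. *)
Lemma facet_of_mod : (k = 1 %[mod q])%N -> (k = (3 * q + 1)%N -> q = 3 \/ ~~ odd q) ->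
  induces_facet (@CPP R V) (@chorded_cycle_lhs R q k) (chorded_cycle_rhs R q k).
Proof.
rewrite [(1 %% q)%N]modn_small // => k1 hodd; rewrite lhsE; split.
  move=> x [n [p [w [hp w0 w1 ->]]]]; rewrite dot_sumr -[leRHS]mul1r -w1 mulr_suml.
  apply: ler_sum => i _; rewrite dotC dotZl dotC ler_wpM2l //.
  by have [Pi hPi ->] := hp i; apply: lhs_le.
exists (#|edge V|.+1%:Z - 1); split; first exact: CPP_full_dim.
exists #|edge V|; split.
- lia.
- pose T := [pred Pi : {set {set V}} | finset.partition Pi [set: V]%SET &&
    (load q k (label Pi) == (k + q.-1) %/ q)%N].
  have kE := divn_eq k q; rewrite k1 in kE; set m := (k %/ q)%N in kE.
  have m2 : (2 <= m)%N by nia.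
  have CE : ((k + q.-1) %/ q = m.+1)%N.
    by rewrite kE (_ : m * q + 1 + q.-1 = m.+1 * q)%N ?mulnK //; lia.
  (* A tight labelling of [[0, k)], rotated to start at [x], is realised by a tight partition of the
     vertices; [y] represents [- x] modulo [k]. *)
  have tightT (lab : nat -> nat) (x : nat) :
      load q k (fun i => lab (i %% k)%N) = m.+1 -> exists2 Pi, Pi \in T &
      forall s t, (s < k)%N -> (t < k)%N ->
        (label Pi (x + s) == label Pi (x + t)) = (lab s == lab t).
    move=> hl; pose y := (k - x %% k)%N.
    have kx : (x %% k < k)%N by rewrite ltn_mod; lia.
    pose f (z : V) : nat := lab (z + pt y : V).
    have fE i : f (pt i) = lab ((i + y) %% k)%N by rewrite /f ptD /= val_Zp_nat ?k_gt1.
    pose Pi := finset.preim_partition f [set: V]%SET.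
    have eqE i j : (label Pi i == label Pi j) = (f (pt i) == f (pt j)) by apply: pblock_preim.
    exists Pi.
      rewrite inE finset.preim_partitionP /= CE -hl; apply/eqP.
      rewrite -[RHS](load_shift q y) => [|i]; last by rewrite modnDr.
      by apply: eq_load => i j; rewrite eqE !fE.
    have xs s : (s < k)%N -> ((x + s + y) %% k = s)%N.
      move=> sk; have xE := divn_eq x k.
      rewrite (_ : (x + s + y)%N = ((x %/ k).+1 * k + s)%N); last by rewrite /y mulSn; lia.
      by rewrite modnMDl modn_small.
    by move=> s t sk tk; rewrite eqE !fE !xs.
  have [||||p' [ip hp]] := @affine_hyperplane_basis R (edge V) #|T|
    (fun l => partition_vector R (enum_val l)) phi (chorded_cycle_rhs R q k); last first.
  + exists p'; split=> // i; have [j ->] := hp i.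
    have /andP[hP /eqP hl] := enum_valP j.
    by split; [apply: vertex_CPP | apply/lhs_eq].
  + move=> a b hab; have hT Pi : Pi \in T -> dot a (partition_vector R Pi) = b.
      by move=> hPi; rewrite -[RHS](hab (enum_rank_in hPi Pi)) enum_rankK_in.
    pose A i j := coord_at (a : edge_vector R V) (pt i) (pt j).
    have A_sym i j : A i j = A j i by apply: coord_atC.
    have A_per i j : A (i + (m * q + 1))%N j = A i j by rewrite /A -kE pt_per.
    have A_tight lab x : lab_tight q m lab ->
        \sum_(0 <= s < m * q + 1) \sum_(0 <= t < m * q + 1)
          (lab s == lab t)%:R * A (x + s)%N (x + t)%N = b *+ 2.
      rewrite /lab_tight -kE => /(tightT _ x)[Pi hPi hlab].
      rewrite -(hT _ hPi) -double_dot (sum_pt_shift x); apply: eq_big_nat => s /= sk.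
      rewrite (sum_pt_shift x); apply: eq_big_nat => t /= tk.
      have [->|st] := eqVneq s t; first by rewrite /A !coord_at_diag mulr0 mul0r.
      rewrite mulrC; congr (_ * _); have /andP[hP _] := hPi.
      by rewrite coord_partition ?hlab // pt_eq eqn_modDl !modn_small.
    have hval := annihilator_values hq m2 A_sym A_per A_tight.
    have {}hval x d : (0 < d < k)%N -> A x (x + d)%N = A 0%N 1%N *
        ((d == 1%N)%:R + (d == k - 1)%N%:R - (d == q)%:R - (d == k - q)%N%:R).
      by rewrite kE => hd; apply: hval => // m3; apply: hodd; rewrite kE m3.
    exists (A 0%N 1%N); apply/ffunP => e; rewrite -dot_delta -[RHS]dot_delta dotZl.
    (* Proportionality is checked on an arbitrary [y], summing over a vertex and a difference. Only
       the differences 1, [k - 1], [q] and [k - q] contribute, and [Yback] identifies complementary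
       ones. *)
    move: (delta R e) => y; pose Y i d := coord_at (y : edge_vector R V) (pt i) (pt (i + d)).
    have Yback d : (d <= k)%N -> \sum_(0 <= i < k) Y i (k - d)%N = \sum_(0 <= i < k) Y i d.
      move=> dk; rewrite -(@big_shift_period _ _ +%R k d (fun i => Y i (k - d)%N)) /=.
        by apply: eq_bigr => i _; rewrite /Y -addnA subnKC // pt_per coord_atC.
      by move=> i; rewrite /Y addnAC !pt_per.
    suff : dot a y *+ 2 = A 0%N 1%N * dot phi y *+ 2 by lra.
    rewrite -double_dot sum_pt lhs_pt.
    rewrite (eq_bigr (fun i => A 0%N 1%N *
       (Y i 1%N + Y i (k - 1)%N - Y i q - Y i (k - q)%N))) => [|i _]; last first.
      have dl l : (l < k)%N -> Y i l = \sum_(0 <= d < k) (d == l)%:R * Y i d.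
        by move=> ek; rewrite sum_delta.
      rewrite (sum_pt_shift i) (dl 1%N) ?(dl (k - 1)%N) ?(dl q) ?(dl (k - q)%N); try lia.
      rewrite -big_split -!sumrB mulr_sumr; apply: eq_big_nat => d /= dk.
      have [->|d0] := posnP d; first last.
        by rewrite -/(A i (i + d)%N) hval ?d0 // -/(Y i d); ring.
      have -> : (0 == 1)%N = false by [].
      have -> : (0 == k - 1)%N = false by lia.
      have -> : (0 == q)%N = false by lia.
      have -> : (0 == k - q)%N = false by lia.
      by rewrite addn0 !coord_at_diag; ring.
    rewrite -mulr_sumr sumrB sumrB big_split /= !Yback; try lia.
    by rewrite sumrB -/(Y _ _); ring.
  + by move=> i; have /andP[hP /eqP hl] := enum_valP i; apply/lhs_eq.
  + exact: phi_neq0.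
  + have [|Pi hPi _] := tightT (seg q 1 0 q.+1) 0%N.
      by have := @seg0_tight q m hq m2 1 q.+1; rewrite /lab_tight -kE; apply; lia.
    by apply/card_gt0P; exists Pi.
move=> n p ip hp; apply: (leq_affine1 (b := chorded_cycle_rhs R q k) phi_neq0 _ ip).
by move=> i; have [] := hp i.
Qed.

End CyclicIndices.

Theorem theorem1 (R : realType) (q k : nat)
  (hq : (2 <= q)%N) (hqk : (2 * q <= k)%N) :
  induces_facet (@CPP R 'Z_k) (@chorded_cycle_lhs R q k)
    (@chorded_cycle_rhs R q k)
  <->
  (k = 1 %[mod q])%N /\ (k = (3 * q + 1)%N -> q = 3 \/ ~~ odd q).
Proof.
split=> [hf|[k1 hodd]]; last exact: facet_of_mod.
split.
  by apply/eqP/negPn/negP => /(not_facet_of_mod hq hqk)/(_ hf).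
move=> kE; have [/eqP ->|q3] := boolP (q == 3); first by left.
by right; apply/negP => oq; apply: not_facet_of_odd hf.
Qed.
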